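(* Let $r\ge 2$ and let $H$ be a graph with maximum degree $\Delta(H)\ge 2$. There are constants $\eta=\eta(H,r)>0$ and $C=C(H,r)$ such that, if $p=p(n)\ge C n^{-1/m_2(H)}$, then $$\lim_{n\to\infty}\Pr\bigl(\lambda_r(H,G(n,p))\ge \eta\bigr)=1.$$
   Context: $G(n,p)$ is the binomial random graph on $n$ vertices with each edge present independently with probability $p$. For a graph $J$, $d_2(K_2)=1/2$ and $d_2(J)=\frac{e(J)-1}{v(J)-2}$ otherwise; $m_2(H)=\max\{d_2(J):J\subseteq H,\ e(J)\ge1\}$. The $r$-multiplicity $M_r(H,G)$ is the minimum, over all $r$-colourings of the edges of $G$, of the number of monochromatic copies of $H$ in $G$ (so $M_1(H,G)$ is the number of copies of $H$ in $G$), and the Ramsey $r$-robustness is $\lambda_r(H,G)=M_r(H,G)/M_1(H,G)$. *)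

(* Defs.v *)
From HB Require Import structures.
From mathcomp Require Import all_boot all_order all_algebra reals.

Set Implicit Arguments.
Unset Strict Implicit.
Unset Printing Implicit Defensive.

Import Order.TTheory GRing.Theory Num.Theory.
Local Open Scope ring_scope.

Record sgraph (V : finType) := SGraph {
  edges : {set {set V}};
  edgesP : [forall e in edges, #|e| == 2%N]
}.

HB.instance Definition _ (V : finType) := [isSub for @edges V].
HB.instance Definition _ (V : finType) := [Finite of sgraph V by <:].

Definition maxdeg (V : finType) (H : sgraph V) : nat :=
  (\max_(v : V) #|[set e in edges H | v \in e]|)%N.

(* A subgraph, not necessarily spanning, is a pair (vertex set, edge set). *)
Notation vepair V := ({set V} * {set {set V}})%type.

Definition subgraphs (V : finType) (G : sgraph V) : {set vepair V} :=
  [set J : vepair V |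
     (J.2 \subset edges G) && [forall e in J.2, e \subset J.1]].

Definition d2 (R : realType) (V : finType) (J : vepair V) : R :=
  if (#|J.1| == 2%N) && (#|J.2| == 1%N) then 1 / 2
  else (#|J.2|%:R - 1) / (#|J.1|%:R - 2).

(* All the values d2 J with e(J) >= 1 are nonnegative, so the default value 0
   does not affect the maximum as soon as H has an edge. *)
Definition m2 (R : realType) (V : finType) (H : sgraph V) : R :=
  \big[Num.max/0]_(J : vepair V | (J \in subgraphs H) && (1 <= #|J.2|)%N)
     d2 R J.

(* Unlabelled copies: the subgraphs of G isomorphic to H. *)
Definition copies (V W : finType) (H : sgraph V) (G : sgraph W) :
    {set vepair W} :=
  [set J : vepair W in subgraphs G |
     [exists f : {ffun V -> W}, injectiveb f &&
        (J == ([set f x | x : V], [set f @: (e : {set V}) | e in edges H]))]].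

Definition mono_copies (r : nat) (V W : finType) (H : sgraph V) (G : sgraph W)
    (c : {ffun {e : {set W} | e \in edges G} -> 'I_r}) : {set vepair W} :=
  [set J : vepair W in copies H G |
     [exists i : 'I_r, forall e : {e : {set W} | e \in edges G},
        (val e \in J.2) ==> (c e == i)]].

(* No colouring has more than #|copies H G| monochromatic copies, so this
   default value does not affect the minimum as soon as r >= 1. *)
Definition multiplicity (r : nat) (V W : finType) (H : sgraph V)
    (G : sgraph W) : nat :=
  \big[minn/#|copies H G|]_(c : {ffun {e : {set W} | e \in edges G} -> 'I_r})
     #|mono_copies H c|.

(* Equal to 0 when G contains no copy of H. *)
Definition robustness (R : realType) (r : nat) (V W : finType) (H : sgraph V)
    (G : sgraph W) : R :=
  (multiplicity r H G)%:R / (multiplicity 1 H G)%:R.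

Definition Gnp_mass (R : realType) (n : nat) (p : R) (G : sgraph 'I_n) : R :=
  \prod_(e : {set 'I_n} | #|e| == 2%N) (if e \in edges G then p else 1 - p).

Definition Gnp_prob (R : realType) (n : nat) (p : R) (A : pred (sgraph 'I_n))
    : R :=
  \sum_(G : sgraph 'I_n | A G) Gnp_mass p G.

(* Main.v *)
(** A colouring of G(n,p) with few monochromatic copies of H splits the edges
    into classes, each spanning few copies. The hypergraph of copies of H on the
    pairs of vertices has j-degrees O(q^(j-1) n^(v-2)) for every
    q >= n^(-1/m2), so the container method applies with q = theta p, theta a
    small constant: each class I has a fingerprint F(I) of size O(q n^2) inside
    I and lies in a container, determined by F(I), spanning at most eps n^v
    copies. Sparse classes need no special care, because the link hypergraphs
    built by the container algorithm can be followed down to uniformity 0, where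
    their weight bounds the number of copies inside I from below. By Ramsey's
    theorem and averaging, r such containers leave at least delta n^2 pairs
    uncovered, which G(n,p) avoids with probability at most exp(-delta p n^2);
    this beats the number of fingerprints, weighted by p^|F|. Finally the
    total number of copies is at most 2 n^v p^e with high probability, by
    Chebyshev's inequality and the same degree bounds. *)
Require Import Defs.
From mathcomp Require Import all_boot all_order all_algebra.
From mathcomp Require Import ring lra.
From mathcomp Require Import topology normedtype reals sequences exp.

Set Implicit Arguments.
Unset Strict Implicit.
Unset Printing Implicit Defensive.

Import Order.TTheory GRing.Theory Num.Theory.
Import numFieldNormedType.Exports.
Local Open Scope ring_scope.

(** * Selection rules *)

Section SelectionRules.
Variable X : finType.
Implicit Types (I T : {set X}) (f : {set X} -> {set X} * {set X}).

(* The elements (f I).1 of I are selected and the elements (f I).2 outside I are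
   rejected; both sets can be recovered from the selected elements alone. *)
Definition selection_rule f := forall I,
  [/\ (f I).1 \subset I, (f I).2 \subset ~: I &
      forall I', (f I).1 \subset I' -> I' \subset I -> f I' = f I].

Definition rule_seq f (g : {set X} -> {set X} -> {set X} * {set X}) I :=
  let T := (f I).1 in (T :|: (g T I).1, (f I).2 :|: (g T I).2).

Lemma selection_rule0 : selection_rule (fun=> (set0, set0)).
Proof. by move=> I; split; rewrite ?sub0set. Qed.

Lemma selection_rule_seq f g :
  selection_rule f -> (forall T, selection_rule (g T)) -> selection_rule (rule_seq f g).
Proof.
move=> rule_f rule_g I; have [sel_f rej_f replay_f] := rule_f I.
have [sel_g rej_g replay_g] := rule_g (f I).1 I.
rewrite /rule_seq /= !subUset sel_f rej_f sel_g rej_g; split=> // I'.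
rewrite subUset => /andP[/replay_f fI' /replay_g gI'] sI'I.
by rewrite fI' // gI'.
Qed.

End SelectionRules.

(** * Containers for sparse sets of weighted hypergraphs *)

Section WeightedHypergraphs.
Variables (R : realFieldType) (X : finType).
Implicit Types (w u : {set X} -> R) (A B C D I S T : {set X}) (x : X) (s : seq X).

Definition deg w B : R := \sum_(A : {set X} | B \subset A) w A.
Definition mass w C : R := \sum_(A : {set X} | A \subset C) w A.

Definition weight w := forall A, 0 <= w A.
Definition uniform w k C := forall A, w A != 0 -> #|A| = k /\ A \subset C.

Definition spread w k C (K q M : R) :=
  [/\ weight w, uniform w k C &
      forall B, B != set0 -> deg w B <= K * (q ^+ #|B|.-1 * M)].

Lemma deg_ge0 w B : weight w -> 0 <= deg w B.
Proof. by move=> w_ge0; apply: sumr_ge0. Qed.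

Lemma ler_deg w u B : (forall A, w A <= u A) -> deg w B <= deg u B.
Proof. by move=> le_wu; apply: ler_sum. Qed.

Lemma deg_set0 w : deg w set0 = \sum_A w A.
Proof. by apply: eq_bigl => A; rewrite sub0set. Qed.

Lemma massE w C : mass w C = \sum_A w A * (A \subset C)%:R.
Proof.
by rewrite /mass big_mkcond; apply: eq_bigr => A _; case: ifP; rewrite ?mulr1 ?mulr0.
Qed.

Lemma massS w C D : weight w -> C \subset D -> mass w C <= mass w D.
Proof.
move=> w_ge0 sCD; rewrite !massE; apply: ler_sum => A _; apply: ler_wpM2l => //.
by rewrite ler_nat; case: (boolP (A \subset C)) => // sAC; rewrite (subset_trans sAC).
Qed.

Lemma ler_mass w u C : (forall A, w A <= u A) -> mass w C <= mass u C.
Proof. by move=> le_wu; apply: ler_sum. Qed.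

Lemma mass_uniform w k C : uniform w k C -> mass w C = \sum_A w A.
Proof.
move=> w_k; rewrite massE; apply: eq_bigr => A _.
by have [->|/w_k[_ ->]] := eqVneq (w A) 0; rewrite ?mul0r ?mulr1.
Qed.

Lemma reindex_setU1 x (F : {set X} -> R) :
  \sum_(A : {set X} | x \notin A) F (x |: A) = \sum_(A : {set X} | x \in A) F A.
Proof.
rewrite [RHS](reindex_onto (fun A => x |: A) (fun A => A :\ x)) /=.
  apply: eq_bigl => A; rewrite setU11 /=; apply/idP/eqP => [xA|<-].
    by rewrite setU1K.
  by rewrite setD11.
by move=> A xA; rewrite setD1K.
Qed.

Lemma sum_deg w k C : uniform w k C -> \sum_B deg w B = 2 ^+ k * deg w set0.
Proof.
move=> w_k; rewrite /deg (exchange_big_dep predT) //= mulr_sumr.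
apply: eq_big => [A|A _]; first by rewrite sub0set.
rewrite (eq_bigl (mem (powerset A))) => [|B]; last by rewrite /= powersetE.
rewrite sumr_const card_powerset.
have [->|/w_k[-> _]] := eqVneq (w A) 0; first by rewrite mul0rn mulr0.
by rewrite -[LHS]mulr_natl natrX.
Qed.

Section Scan.
Variables (w : {set X} -> R) (D : nat -> R) (theta : R).

Definition saturated u B := D #|B| <= deg u B.
Definition unsaturated u A := [forall B : {set X}, (B \subset A) ==> ~~ saturated u B].
Definition link u x A := if (x \notin A) && unsaturated u A then w (x |: A) else 0.
Definition contribution u x := \sum_(A : {set X}) link u x A.
Definition heavy u x := theta <= contribution u x.
Definition add_link u x A := u A + link u x A.

Record scan_state :=
  ScanState { derived : {set X} -> R; selected : {set X}; rejected : {set X} }.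

(* The decision at x depends on I only through x itself and the elements
   selected before x, so the run can be replayed from the selected set alone. *)
Fixpoint scan I u s : scan_state :=
  if s is x :: s' then
    if ~~ heavy u x then scan I u s'
    else if x \in I then
      let r := scan I (add_link u x) s' in ScanState (derived r) (x |: selected r) (rejected r)
    else
      let r := scan I u s' in ScanState (derived r) (selected r) (x |: rejected r)
  else ScanState u set0 set0.

Definition link_pass I := scan I (fun=> 0) (enum X).
Definition link_rule I := (selected (link_pass I), rejected (link_pass I)).

Lemma selected_sub I u s : selected (scan I u s) \subset I.
Proof.
elim: s u => [|x s IH] u /=; first exact: sub0set.
by case: ifP => // _; case: ifP => //= xI; rewrite subUset sub1set xI IH.
Qed.

Lemma rejected_sub I u s : rejected (scan I u s) \subset ~: I.
Proof.
elim: s u => [|x s IH] u /=; first exact: sub0set.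
by case: ifP => // _; case: ifP => //= xI; rewrite subUset sub1set inE xI IH.
Qed.

Lemma rejected_support I u s k C :
  0 < theta -> uniform w k C -> rejected (scan I u s) \subset C.
Proof.
move=> theta_gt0 w_k; elim: s u => [|x s IH] u /=; first exact: sub0set.
case: ifP => // /negbFE heavy_x; case: ifP => //= _.
rewrite subUset sub1set IH andbT; apply: contraLR heavy_x => xC.
rewrite /heavy -ltNge /contribution big1 // => A _.
rewrite /link; case: ifP => // _; apply/eqP/negPn/negP => /w_k[_].
by rewrite subUset sub1set (negbTE xC).
Qed.

Lemma scan_replay I I' u s :
  selected (scan I u s) \subset I' -> I' \subset I -> scan I' u s = scan I u s.
Proof.
move=> + sI'I; elim: s u => [//|x s IH] u /=; case: ifP => [_|heavy_x]; first exact: IH.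
have [xI|xI] /= := boolP (x \in I).
  by rewrite subUset sub1set => /andP[-> /IH->].
by move=> /IH->; rewrite (contraNF (subsetP sI'I x)).
Qed.

Lemma link_rule_selection : selection_rule link_rule.
Proof.
move=> I; split=> [||I' sTI' sI'I]; [exact: selected_sub | exact: rejected_sub|].
by rewrite /link_rule /link_pass (scan_replay sTI' sI'I).
Qed.

Lemma link_pass_selected I : link_pass (selected (link_pass I)) = link_pass I.
Proof. by rewrite {1}/link_pass (@scan_replay I) // selected_sub. Qed.

Lemma link_ge0 : weight w -> forall u x, weight (link u x).
Proof. by move=> w_ge0 u x A; rewrite /link; case: ifP. Qed.

Lemma link_le u x A : weight w -> link u x A <= if x \notin A then w (x |: A) else 0.
Proof. by move=> w_ge0; rewrite /link; case: (x \notin A) => //=; case: ifP. Qed.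

Lemma deg_add_link u x B : deg (add_link u x) B = deg u B + deg (link u x) B.
Proof. exact: big_split. Qed.

Lemma unsaturated_le u u' A :
  (forall B, u B <= u' B) -> unsaturated u' A -> unsaturated u A.
Proof.
move=> le_uu' /forallP unsat; apply/forallP => B; apply/implyP => sBA.
have := unsat B; rewrite sBA; apply: contra => sat.
exact: le_trans sat (ler_deg _ le_uu').
Qed.

Lemma uniform_derived I u s k C :
  uniform w k.+1 C -> uniform u k C -> uniform (derived (scan I u s)) k C.
Proof.
move=> w_k; elim: s u => [//|x s IH] u u_k /=.
case: ifP => _; first exact: IH; case: ifP => _ /=; apply: IH => // A.
have [uA|/u_k//] := eqVneq (u A) 0.
rewrite /add_link uA add0r /link; case: ifP => [/andP[xA _] /w_k[]|]; last by rewrite eqxx.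
by rewrite cardsU1 xA subUset => -[<-] /andP[_ ->].
Qed.

Hypothesis w_ge0 : weight w.

Lemma derived_ge I u s A : u A <= derived (scan I u s) A.
Proof.
elim: s u => [//|x s IH] u /=; case: ifP => // _; case: ifP => //= _.
by apply: le_trans (IH _); rewrite lerDl link_ge0.
Qed.

Lemma contribution_le u u' x :
  (forall A, u A <= u' A) -> contribution u' x <= contribution u x.
Proof.
move=> le_uu'; apply: ler_sum => A _; rewrite /link.
case: (x \notin A) => //=; case: ifP => [/(unsaturated_le le_uu')-> //|_].
by case: ifP.
Qed.

Lemma heavy_scanned I u s x : x \in s -> heavy (derived (scan I u s)) x ->
  x \in selected (scan I u s) :|: rejected (scan I u s).
Proof.
elim: s u => [//|y s IH] u; rewrite inE => /predU1P[->|xs] /=.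
  have [heavy_y _|light_y] /= := boolP (heavy u y).
    by case: ifP => _ /=; rewrite !inE eqxx ?orbT.
  move=> /le_trans/(_ (contribution_le _ (derived_ge I u s))).
  by rewrite -/(heavy u y) (negbTE light_y).
case: ifP => _; first exact: IH.
by case: ifP => _ /= /(IH _ xs); rewrite !inE => /orP[] ->; rewrite ?orbT.
Qed.

Lemma card_selected_le I u s : 0 <= theta ->
  #|selected (scan I u s)|%:R * theta + deg u set0 <= deg (derived (scan I u s)) set0.
Proof.
move=> theta_ge0; elim: s u => [|x s IH] u /=; first by rewrite cards0 mul0r add0r.
case: ifP => // /negbFE; rewrite /heavy /contribution => heavy_x; case: ifP => //= _.
apply: le_trans (IH _); rewrite deg_add_link (deg_set0 (link u x)).
set T := selected _.
have : #|x |: T|%:R * theta <= (1 + #|T|%:R) * theta.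
  by rewrite ler_wpM2r // nat1r ler_nat cardsU1; case: (x \notin _).
lra.
Qed.

Lemma deg_link_le u x B : deg (link u x) B <= if x \in B then 0 else deg w (x |: B).
Proof.
case: ifP => xB.
  by rewrite /deg big1 // => A sBA; rewrite /link (subsetP sBA _ xB).
apply: le_trans (ler_sum _ (fun A _ => link_le u x A w_ge0)) _.
rewrite -big_mkcondr /= (eq_bigl (fun A => (x \notin A) && (x |: B \subset x |: A))).
  rewrite big_mkcondr /= (reindex_setU1 x (fun A => if x |: B \subset A then w A else 0)).
  rewrite -big_mkcondr big_mkcondl; apply: ler_sum => A _.
  by case: ifP.
move=> A; rewrite andbC; have [//|xA /=] := boolP (x \in A).
have /setIidPl sBx : B \subset ~: [set x] by rewrite subsetC sub1set inE xB.
by rewrite subUset sub1set setU11 -[RHS]subDset setDE sBx.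
Qed.

Lemma deg_derived_le I u s B (d : R) :
    0 <= d -> (forall x, x \notin B -> deg w (x |: B) <= d) ->
  deg u B <= D #|B| + d -> deg (derived (scan I u s)) B <= D #|B| + d.
Proof.
move=> d_ge0 le_d; elim: s u => [//|x s IH] u deg_u /=.
case: ifP => _; first exact: IH; case: ifP => _ /=; apply: IH => //.
rewrite deg_add_link; have [sat|] := boolP (saturated u B).
  rewrite {2}/deg big1 ?addr0 // => A sBA; rewrite /link.
  case: (x \notin A) => //=; case: ifP => // /forallP/(_ B).
  by rewrite sBA sat.
rewrite /saturated -ltNge => /ltW le_D; apply: lerD => //.
by apply: le_trans (deg_link_le _ _ _) _; case: ifP => // /negbT; apply: le_d.
Qed.

Lemma derived_le I u s A : derived (scan I u s) A <=
  u A + \sum_(x <- s | (x \in I) && (x \notin A)) w (x |: A).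
Proof.
elim: s u => [|x s IH] u /=; first by rewrite big_nil addr0.
rewrite big_cons; case: ifP => _.
  by apply: le_trans (IH _) _; rewrite lerD2l; case: ifP => // _; rewrite lerDr.
case: ifP => _ /=; last exact: IH.
apply: le_trans (IH _) _; rewrite /add_link -addrA lerD2l.
by have := link_le u x A w_ge0; case: ifP => _ le_link; rewrite ?lerD2r // gerDr.
Qed.

Lemma mass_derived_le I k C : uniform w k.+1 C ->
  mass (derived (link_pass I)) I <= k.+1%:R * mass w I.
Proof.
move=> w_k; apply: le_trans (ler_sum _ (fun A _ => derived_le I _ _ A)) _.
under eq_bigr do rewrite add0r big_enum_cond /=.
rewrite (exchange_big_dep (mem I)) /= => [|A x _ /andP[]//].
have sum_insert x : x \in I ->
    \sum_(A : {set X} | (A \subset I) && ((x \in I) && (x \notin A))) w (x |: A)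
    = \sum_(A : {set X} | (A \subset I) && (x \in A)) w A.
  move=> xI; rewrite (eq_bigl (fun A => (x \notin A) && (x |: A \subset I))) => [|A].
    rewrite big_mkcondr /= (reindex_setU1 x (fun A => if A \subset I then w A else 0)).
    by rewrite -big_mkcondr /=; apply: eq_bigl => A; rewrite andbC.
  by rewrite xI subUset sub1set xI /= andbC.
rewrite (eq_bigr _ sum_insert) (exchange_big_dep (fun A => A \subset I)) => [|x A _ /andP[]//].
rewrite mulr_sumr; apply: ler_sum => A sAI /=; rewrite sumr_const.
have [->|/w_k[<- _]] := eqVneq (w A) 0; first by rewrite mul0rn mulr0.
rewrite -[leLHS]mulr_natl ler_wpM2r // ler_nat; apply: subset_leq_card.
by apply/subsetP => x; rewrite unfold_in => /and3P[].
Qed.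

Lemma sum_unsaturated_le u k C : uniform w k.+1 C ->
  \sum_(A : {set X} | unsaturated u A) w A <= \sum_(x in C) contribution u x.
Proof.
move=> w_k.
have le_contribution x :
    \sum_(A : {set X} | (x \in A) && unsaturated u A) w A <= contribution u x.
  rewrite big_mkcondr /= -(reindex_setU1 x (fun A => if unsaturated u A then w A else 0)).
  rewrite /contribution big_mkcond; apply: ler_sum => A _; rewrite /link.
  case: (x \notin A) => //=; case: ifP => [/forallP unsat|]; last by case: ifP.
  rewrite ifT //; apply/forallP => B; apply/implyP => sBA.
  by have /implyP := unsat B; apply; apply: subset_trans sBA (subsetUr _ _).
apply: le_trans (ler_sum _ (fun x _ => le_contribution x)).
rewrite (exchange_big_dep (unsaturated u)) /= => [|x A _ /andP[]//].
apply: ler_sum => A unsat; rewrite sumr_const.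
have [->|/w_k[cardA sAC]] := eqVneq (w A) 0; first by rewrite mul0rn.
rewrite -[leRHS]mulr_natl ler_peMl // ler1n.
have /card_gt0P[x xA] : (0 < #|A|)%N by rewrite cardA.
by apply/card_gt0P; exists x; rewrite unfold_in /= (subsetP sAC) // xA.
Qed.

Lemma sum_saturated_le u (L : R) k C :
    weight u -> uniform u k C -> 0 <= L -> ~~ saturated u set0 ->
    (forall B, B != set0 -> deg w B <= L * D #|B|) ->
  \sum_(A : {set X} | ~~ unsaturated u A) w A <= L * 2 ^+ k * deg u set0.
Proof.
move=> u_ge0 u_k L_ge0 nsat0 le_L.
apply: (@le_trans _ _ (\sum_(B : {set X} | saturated u B) deg w B)).
  rewrite /deg (exchange_big_dep predT) //= [leLHS]big_mkcond; apply: ler_sum => A _.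
  case: ifP => [|_]; last exact: sumr_ge0.
  rewrite negb_forall => /existsP[B]; rewrite negb_imply negbK => /andP[sBA satB].
  by rewrite (bigD1 B) ?satB //= lerDl sumr_ge0.
rewrite -mulrA -(sum_deg u_k) mulr_sumr big_mkcond; apply: ler_sum => B _.
case: ifP => [satB|_]; last by rewrite mulr_ge0 // deg_ge0.
apply: le_trans (le_L B _) _; first by apply: contraNneq nsat0 => <-.
by rewrite ler_wpM2l.
Qed.

Lemma contribution_le_deg u x : contribution u x <= deg w [set x].
Proof.
have := deg_link_le u x set0.
by rewrite in_set0 setU0 deg_set0.
Qed.

Lemma sum_contribution_le I C (d : R) : 0 <= theta -> 0 <= d ->
    (forall x, deg w [set x] <= d) ->
  \sum_(x in C) contribution (derived (link_pass I)) x
    <= (#|selected (link_pass I)| + #|rejected (link_pass I)|)%:R * d + theta * #|C|%:R.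
Proof.
move=> theta_ge0 d_ge0 le_d; set r := link_pass I.
rewrite (bigID (heavy (derived r))) /=; apply: lerD.
  apply: (@le_trans _ _ (\sum_(x in selected r :|: rejected r) d)).
    rewrite big_mkcond [leRHS]big_mkcond; apply: ler_sum => x _.
    case: ifP => [/andP[_ heavy_x]|_].
      by rewrite heavy_scanned ?mem_enum // (le_trans (contribution_le_deg _ _)).
    by case: ifP.
  by rewrite sumr_const -[leLHS]mulr_natl ler_wpM2r // ler_nat cardsU leq_subr.
apply: (@le_trans _ _ (\sum_(x in C) theta)); last by rewrite sumr_const mulr_natr.
rewrite big_mkcondr /=; apply: ler_sum => x _.
by case: ifP => //; rewrite /heavy -ltNge => /ltW.
Qed.

End Scan.
Definition rejecting k w C (q M N a alpha c rho : R) f :=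
  selection_rule f /\ forall I,
  [/\ (f I).2 \subset C, #|(f I).1|%:R <= c * (q * N) &
      a * (M * N) <= deg w set0 -> mass w I < alpha * (q ^+ k * (M * N)) ->
      rho * N <= #|(f I).2|%:R].

Lemma rejecting_uniform0 w C q M N a : uniform w 0 C -> 1 <= q * N ->
  rejecting 0 w C q M N a a 1 1 (fun=> (set0, set0)).
Proof.
move=> w_0 qN; split=> [|I]; first exact: selection_rule0.
rewrite sub0set cards0 !mul1r deg_set0; split=> // [|w_large]; first exact: le_trans qN.
rewrite (@mass_uniform w 0 I) => [|A /w_0[/eqP]]; first by rewrite ltNge w_large.
by rewrite cards_eq0 => /eqP-> _; rewrite cards0 sub0set.
Qed.

Section SparseLink.
Variables (k : nat) (w : {set X} -> R) (C : {set X}) (K q M N a b : R).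
Hypotheses (K_gt0 : 0 < K) (q_gt0 : 0 < q) (M_gt0 : 0 < M) (a_gt0 : 0 < a) (b_gt0 : 0 < b).
Hypotheses (qN_ge1 : 1 <= q * N) (CN : #|C|%:R <= N) (w_spread : spread w k.+1 C K q M).

Definition link_threshold j := if j is 0 then b * (q * M * N) else q ^+ j * M.
Definition sparse_pass := link_pass w link_threshold (a * M / 4).

Let w_ge0 : weight w. Proof. by case: w_spread. Qed.
Let w_uniform : uniform w k.+1 C. Proof. by case: w_spread. Qed.
Let N_gt0 : 0 < N.
Proof. by rewrite -(pmulr_rgt0 _ q_gt0); apply: lt_le_trans qN_ge1. Qed.
Let KM_ge0 : 0 <= K * M. Proof. by rewrite mulr_ge0 // ltW. Qed.
Let heaviness_gt0 : 0 < a * M / 4. Proof. by rewrite divr_gt0 ?mulr_gt0. Qed.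

Let deg_set1_le x : deg w [set x] <= K * M.
Proof.
have [_ _ /(_ [set x])] := w_spread; rewrite cards1 mul1r; apply.
by apply/set0Pn; exists x; rewrite set11.
Qed.

Lemma uniform_sparse_pass I : uniform (derived (sparse_pass I)) k C.
Proof. by apply: uniform_derived => // A; rewrite eqxx. Qed.

Lemma spread_sparse_pass I : spread (derived (sparse_pass I)) k C (K + 1) q (q * M).
Proof.
have [_ _ deg_w] := w_spread; have qM_ge0 j : 0 <= q ^+ j * M.
  by rewrite mulr_ge0 ?exprn_ge0 // ltW.
split=> [A||B B_neq0]; [exact: derived_ge | exact: uniform_sparse_pass |].
have [j cardB] : exists j, #|B| = j.+1 by exists #|B|.-1; rewrite prednK // card_gt0.
have -> : (K + 1) * (q ^+ #|B|.-1 * (q * M)) = link_threshold #|B| + K * (q ^+ #|B| * M).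
  by rewrite cardB /= exprS; ring.
apply: deg_derived_le => // [|x xB|]; first by rewrite mulr_ge0 // ltW.
  apply: le_trans (deg_w _ _) _; first by apply/set0Pn; exists x; rewrite setU11.
  by rewrite cardsU1 xB.
by rewrite /deg big1 // cardB addr_ge0 //= mulr_ge0 // ltW.
Qed.

Lemma card_sparse_selected_le I :
  #|selected (sparse_pass I)|%:R <= 4 * (b + K) / a * (q * N).
Proof.
have := card_selected_le w link_threshold I (fun=> 0) (enum X) (ltW heaviness_gt0).
have : deg (derived (sparse_pass I)) set0 <= link_threshold #|set0 : {set X}| + K * M.
  apply: deg_derived_le => // [x _|]; first by rewrite setU0.
  by rewrite cards0 /deg big1 // addr_ge0 //= !mulr_ge0 // ltW.
rewrite cards0 -/(link_pass _ _ _ _) -/sparse_pass {2}/deg big1 // addr0 /=.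
move=> deg_le /le_trans/(_ deg_le); set T := #|_|%:R => card_le.
rewrite -(ler_pM2r heaviness_gt0); apply: le_trans card_le _.
have -> : 4 * (b + K) / a * (q * N) * (a * M / 4) = b * (q * M * N) + K * M * (q * N).
  by field; rewrite gt_eqF.
by rewrite lerD2l ler_peMr.
Qed.

(* If the derived weight stays small then few edges contain a saturated set, so
   the contributions of the heavy elements carry most of the weight. *)
Lemma sparse_pass_dichotomy I :
    K * 2 ^+ k * b <= a / 2 -> a * (M * N) <= deg w set0 ->
  b * (q * M * N) <= deg (derived (sparse_pass I)) set0 \/
  a * N <= 4 * K * (#|selected (sparse_pass I)| + #|rejected (sparse_pass I)|)%:R.
Proof.
move=> b_small w_large; set u := derived (sparse_pass I).
have [|u_small] := leP (b * (q * M * N)) (deg u set0); first by left.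
right; have nsat0 : ~~ saturated link_threshold u set0.
  by rewrite /saturated cards0 -ltNge.
have deg_w B : B != set0 -> deg w B <= K / q * link_threshold #|B|.
  have [_ _ le_deg] := w_spread => /[dup] /le_deg; rewrite -card_gt0.
  case: #|B| => //= j + _; rewrite exprS; congr (_ <= _).
  by field; rewrite gt_eqF.
have [u_ge0 u_uniform _] := spread_sparse_pass I.
have sat_small :=
  sum_saturated_le w_ge0 u_ge0 u_uniform (divr_ge0 (ltW K_gt0) (ltW q_gt0)) nsat0 deg_w.
have unsat_small := le_trans (sum_unsaturated_le _ w_ge0 u w_uniform)
  (sum_contribution_le _ w_ge0 I C (ltW heaviness_gt0) KM_ge0 deg_set1_le).
move: w_large; rewrite deg_set0 (bigID (unsaturated link_threshold u)) /=.
have total_sat : K / q * 2 ^+ k * deg u set0 <= a / 2 * (M * N).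
  apply: (@le_trans _ _ (K / q * 2 ^+ k * (b * (q * M * N)))).
    by apply: ler_wpM2l (ltW u_small); rewrite mulr_ge0 ?exprn_ge0 // divr_ge0 // ltW.
  have -> : K / q * 2 ^+ k * (b * (q * M * N)) = K * 2 ^+ k * b * (M * N).
    by field; rewrite gt_eqF.
  by rewrite ler_wpM2r // mulr_ge0 // ltW.
have light_small : a * M / 4 * #|C|%:R <= a * M / 4 * N by rewrite ler_wpM2l // ltW.
set t := (_ + _)%:R in unsat_small *; set unsat := \sum_(A | _) _ in unsat_small *.
move=> total; rewrite -(ler_pM2r M_gt0); move: total sat_small unsat_small; rewrite -/u.
lra.
Qed.

(* Either the pass alone rejects linearly many elements, or the derived weight is
   large again and the second rule does so. *)
Lemma rejecting_seq alpha c rho g :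
    K * 2 ^+ k * b <= a / 2 -> 4 * (b + K) / a * q <= a / (8 * K) ->
    (forall T, rejecting k (derived (sparse_pass T)) C q (q * M) N b alpha c rho (g T)) ->
  rejecting k.+1 w C q M N a (alpha / k.+1%:R) (4 * (b + K) / a + c)
    (Num.min rho (a / (8 * K))) (rule_seq (link_rule w link_threshold (a * M / 4)) g).
Proof.
move=> b_small q_small rej_g; split=> [|I].
  by apply: selection_rule_seq (link_rule_selection _ _ _) (fun T => (rej_g T).1).
have [_ /(_ I)] := rej_g (selected (sparse_pass I)).
rewrite [sparse_pass (selected _)]link_pass_selected => -[rej_sub card_sel reject].
split=> [||w_large w_small] /=.
- by rewrite subUset rej_sub (rejected_support _ _ _ _ heaviness_gt0 w_uniform).
- rewrite mulrDl; apply: le_trans (lerD (card_sparse_selected_le I) card_sel).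
  by rewrite -natrD ler_nat cardsU leq_subr.
have [u_large|many] := sparse_pass_dichotomy I b_small w_large.
  apply: (@le_trans _ _ (rho * N)); first by rewrite ler_wpM2r ?ge_min ?lexx // ltW.
  apply: le_trans (reject u_large _) _.
    apply: le_lt_trans (mass_derived_le _ _ w_ge0 I w_uniform) _.
    have -> : alpha * (q ^+ k * (q * M * N)) =
        k.+1%:R * (alpha / k.+1%:R * (q ^+ k.+1 * (M * N))).
      rewrite -{1}[alpha](@divfK _ k.+1%:R) ?pnatr_eq0 // exprS.
      by move: (alpha / _) => y; ring.
    by rewrite ltr_pM2l ?ltr0n.
  by rewrite ler_nat subset_leq_card ?subsetUr.
apply: (@le_trans _ _ (a / (8 * K) * N)).
  by rewrite ler_wpM2r ?ge_min ?lexx ?orbT // ltW.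
apply: (@le_trans _ _ #|rejected (sparse_pass I)|%:R); last first.
  by rewrite ler_nat subset_leq_card ?subsetUl.
have sel_le : #|selected (sparse_pass I)|%:R <= a / (8 * K) * N.
  apply: le_trans (card_sparse_selected_le I) _.
  by rewrite mulrA; apply: ler_wpM2r q_small; apply: ltW.
have K4_gt0 : 0 < 4 * K by rewrite mulr_gt0.
have half : 4 * K * (a / (8 * K) * N) = a * N / 2 by field; rewrite gt_eqF.
move: sel_le many; rewrite -(ler_pM2l K4_gt0) half natrD => sel_le many.
rewrite -(ler_pM2l K4_gt0) half; lra.
Qed.

End SparseLink.

Definition restrict w C A : R := if A \subset C then w A else 0.

Lemma restrict_le w C A : weight w -> restrict w C A <= w A.
Proof. by move=> w_ge0; rewrite /restrict; case: ifP. Qed.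

Lemma deg_restrict w C : deg (restrict w C) set0 = mass w C.
Proof. by rewrite deg_set0 /mass [RHS]big_mkcond. Qed.

Lemma spread_restrict w k C D K q M :
  spread w k D K q M -> spread (restrict w C) k C K q M.
Proof.
move=> [w_ge0 w_k deg_w]; split=> [A|A|B B_neq0].
- by rewrite /restrict; case: ifP.
- by rewrite /restrict; case: ifP => [sAC /w_k[]|]; rewrite ?eqxx.
- by apply: le_trans (deg_w _ B_neq0); apply: ler_deg => A; apply: restrict_le.
Qed.

End WeightedHypergraphs.

Lemma rejecting_rule (R : realFieldType) (k : nat) (K a : R) : 0 < K -> 0 < a ->
  exists alpha c rho q1 : R, [/\ 0 < alpha, 0 < c, 0 < rho, 0 < q1 &
    forall (X : finType) (C : {set X}) (w : {set X} -> R) (q M N : R),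
    0 < q -> q <= q1 -> 0 < M -> 1 <= q * N -> #|C|%:R <= N -> spread w k C K q M ->
    exists f, rejecting k w C q M N a alpha c rho f].
Proof.
elim: k K a => [|k IH] K a K_gt0 a_gt0.
  exists a, 1, 1, 1; split=> // X C w q M N _ _ _ qN _ [_ w_0 _].
  by exists (fun=> (set0, set0)); apply: rejecting_uniform0.
pose b := a / (K * 2 ^+ k.+1).
have b_gt0 : 0 < b by rewrite divr_gt0 // mulr_gt0 // exprn_gt0.
have [||alpha [c [rho [q1 [alpha_gt0 c_gt0 rho_gt0 q1_gt0 step]]]]] := IH (K + 1) b => //.
  exact: addr_gt0.
have sel_gt0 : 0 < 4 * (b + K) / a by rewrite divr_gt0 // mulr_gt0 // addr_gt0.
have rej_gt0 : 0 < a / (8 * K) by rewrite divr_gt0 // mulr_gt0.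
exists (alpha / k.+1%:R), (4 * (b + K) / a + c), (Num.min rho (a / (8 * K))),
  (Num.min q1 (a / (8 * K) / (4 * (b + K) / a))); split.
- exact: divr_gt0.
- exact: addr_gt0.
- by rewrite lt_min rho_gt0.
- by rewrite lt_min q1_gt0 divr_gt0.
move=> X C w q M N q_gt0; rewrite le_min => /andP[q_le_q1].
rewrite ler_pdivlMr // mulrC => q_small M_gt0 qN CN w_spread.
have [T|g rej_g] := fin_all_exists (P := fun T f =>
  rejecting k (derived (sparse_pass w q M N a b T)) C q (q * M) N b alpha c rho f).
  by apply: step => //; [exact: mulr_gt0 | exact: spread_sparse_pass].
exists (rule_seq (link_rule w (link_threshold q M N b) (a * M / 4)) g).
apply: rejecting_seq rej_g => //.
rewrite /b exprS; have -> : K * 2 ^+ k * (a / (K * (2 * 2 ^+ k))) = a / 2; last by [].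
by field; rewrite !gt_eqF ?exprn_gt0.
Qed.

Lemma rejecting_iter (R : realFieldType) (X : finType) (k : nat) (w : {set X} -> R)
    (S : {set X}) (q M N a alpha c rho : R) : weight w ->
    (forall C : {set X}, C \subset S ->
      exists f, rejecting k (restrict w C) C q M N a alpha c rho f) ->
  forall m (C : {set X}), C \subset S ->
  exists f, [/\ selection_rule f, forall I, #|(f I).1|%:R <= m%:R * (c * (q * N)) &
    forall I : {set X}, I \subset C -> mass w I < alpha * (q ^+ k * (M * N)) ->
    #|C|%:R < m%:R * (rho * N) -> mass w (C :\: (f I).2) < a * (M * N)].
Proof.
move=> w_ge0 rej; elim=> [|m IH] C sCS.
  exists (fun=> (set0, set0)); split=> [|I|I _ _]; first exact: selection_rule0.
    by rewrite cards0 mul0r.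
  by rewrite mul0r ltNge ler0n.
have [f [rule_f rej_f]] := rej C sCS.
have [T|g rej_g] := fin_all_exists (P := fun T h => [/\ selection_rule h,
    forall I, #|(h I).1|%:R <= m%:R * (c * (q * N)) &
    forall I : {set X}, I \subset C :\: (f T).2 -> mass w I < alpha * (q ^+ k * (M * N)) ->
    #|C :\: (f T).2|%:R < m%:R * (rho * N) ->
    mass w (C :\: (f T).2 :\: (h I).2) < a * (M * N)]).
  exact: IH (subset_trans (subsetDl _ _) sCS).
exists (rule_seq f g); split=> [|I|I sIC I_small C_small] /=.
- by apply: selection_rule_seq => // T; have [] := rej_g T.
- have [_ sel_f _] := rej_f I; have [_ sel_g _] := rej_g (f I).1.
  rewrite -nat1r mulrDl mul1r; apply: le_trans (lerD sel_f (sel_g I)).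
  by rewrite -natrD ler_nat cardsU leq_subr.
have [rejC _ reject] := rej_f I; have [sel_sub rej_sub replay] := rule_f I.
have := rej_g (f I).1; rewrite (replay _ (subxx _) sel_sub) => -[_ _ /(_ I)].
rewrite -setDDl; have [few|many] := ltP (mass w C) (a * (M * N)).
  by move=> _; apply: le_lt_trans few; apply: massS => //; rewrite setDDl subsetDl.
apply=> //; first by rewrite subsetD sIC disjoint_sym disjoints_subset.
have : rho * N <= #|(f I).2|%:R.
  apply: reject; first by rewrite deg_restrict.
  by apply: le_lt_trans I_small; apply: ler_mass => A; apply: restrict_le.
move: C_small; rewrite -nat1r mulrDl mul1r -(cardsID (f I).2 C) (setIidPr rejC) natrD.
lra.
Qed.

Theorem sparse_containers (R : archiRealFieldType) (k : nat) (K eps : R) :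
    0 < K -> 0 < eps ->
  exists alpha c q1 : R, [/\ 0 < alpha, 0 < c, 0 < q1 &
    forall (X : finType) (S : {set X}) (w : {set X} -> R) (q M N : R),
    0 < q -> q <= q1 -> 0 < M -> 1 <= q * N -> #|S|%:R <= N -> spread w k S K q M ->
    exists F C : {set X} -> {set X}, forall I : {set X}, I \subset S ->
    [/\ F I \subset I, I \subset C (F I), #|F I|%:R <= c * (q * N) &
        mass w I < alpha * (q ^+ k * (M * N)) -> mass w (C (F I)) < eps * (M * N)]].
Proof.
move=> K_gt0 eps_gt0.
have [alpha [c [rho [q1 [alpha_gt0 c_gt0 rho_gt0 q1_gt0 rej]]]]] :=
  rejecting_rule k K_gt0 eps_gt0.
pose m := (Num.bound rho^-1).+1.
exists alpha, (m%:R * c), q1; split=> // [|X S w q M N q_gt0 q_le_q1 M_gt0 qN SN w_spread].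
  by rewrite mulr_gt0 ?ltr0n.
have N_gt0 : 0 < N by rewrite -(pmulr_rgt0 _ q_gt0); apply: lt_le_trans qN.
have [w_ge0 _ _] := w_spread.
have rej_restrict (C : {set X}) : C \subset S ->
    exists f, rejecting k (restrict w C) C q M N eps alpha c rho f.
  move=> sCS; apply: rej (spread_restrict _ w_spread) => //.
  by apply: le_trans SN; rewrite ler_nat subset_leq_card.
have [f [rule_f sel_f mass_f]] := rejecting_iter w_ge0 rej_restrict m (subxx S).
have S_small : #|S|%:R < m%:R * (rho * N).
  apply: le_lt_trans SN _; rewrite mulrA ltr_pMl // -ltr_pdivrMr // div1r.
  by apply: lt_trans (archi_boundP _) _; rewrite ?ltr_nat // invr_ge0 ltW.
exists (fun I => (f I).1), (fun T => S :\: (f T).2) => I sIS.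
have [sel_sub rej_sub /(_ _ (subxx _) sel_sub) ->] := rule_f I; split=> //.
- by rewrite subsetD sIS disjoint_sym disjoints_subset.
- by rewrite -mulrA.
- by move=> I_small; apply: mass_f.
Qed.

(** * Ramsey supersaturation *)

Section FiniteCounting.
Local Open Scope nat_scope.

Lemma leq_card_cover_family (T I : finType) (A : {set T}) (P : pred I) (F : I -> {set T}) :
    (forall x, x \in A -> exists2 i, P i & x \in F i) ->
  #|A| <= \sum_(i | P i) #|F i|.
Proof.
move=> cov; under eq_bigr do rewrite -sum1_card.
rewrite (exchange_big_dep predT) //= -sum1_card big_mkcond; apply: leq_sum => x _.
case: ifP => // /cov[i Pi xF]; rewrite sum1_card; apply/card_gt0P; exists i.
by rewrite unfold_in Pi.
Qed.

Lemma pigeonhole_fibre (T J : finType) (A : {set T}) (f : T -> J) (N : J -> nat) :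
  \sum_j N j < #|A| -> exists j, N j < #|[set x in A | f x == j]|.
Proof.
move=> ltA; apply/existsP; apply: contraLR ltA; rewrite negb_exists -leqNgt => /forallP le_N.
apply: (@leq_trans (\sum_j #|[set x in A | f x == j]|)).
  by apply: leq_card_cover_family => x xA; exists (f x); rewrite ?inE ?xA /=.
by apply: leq_sum => j _; rewrite leqNgt.
Qed.

Lemma leq_card_ffun_constrained (I J : finType) (A : {set I}) (P : I -> {set J}) (b : nat) :
    (forall x, x \in A -> #|P x| <= b) ->
  #|[set g : {ffun I -> J} | [forall x in A, g x \in P x]]| <= b ^ #|A| * #|J| ^ (#|I| - #|A|).
Proof.
move=> leP; pose F x := if x \in A then P x else setT.
apply: (@leq_trans #|family (fun x => mem (F x))|).
  apply: subset_leq_card; apply/subsetP => g; rewrite inE => /forall_inP gP.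
  by apply/familyP => x; rewrite /F; case: ifP => [/gP|_]; rewrite ?in_setT.
rewrite card_family foldrE big_map big_enum /= (bigID (mem A)) /=.
apply: leq_mul.
  rewrite -prod_nat_const; apply: leq_prod => x xA; apply: leq_trans (leP x xA).
  by rewrite /F xA; apply: eq_leq; apply: eq_card.
have -> : #|I| - #|A| = #|~: A| by rewrite -(cardsC A) addKn.
rewrite (eq_bigl (mem (~: A))) => [|x]; last by rewrite /= inE.
rewrite -prod_nat_const; apply: leq_prod => x /=; rewrite in_setC => /negbTE xA.
by rewrite /F xA max_card.
Qed.

Lemma leq_card_ffun_comp (V I J : finType) (h : V -> I) (E : {set {ffun V -> J}}) :
    injective h ->
  #|[set g : {ffun I -> J} | [ffun x => g (h x)] \in E]| <= #|E| * #|J| ^ (#|I| - #|V|).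
Proof.
move=> h_inj; pose F f := [set g : {ffun I -> J} | [ffun x => g (h x)] == f].
apply: (@leq_trans (\sum_(f in E) #|F f|)).
  apply: leq_card_cover_family => g; rewrite inE => gE.
  by exists [ffun x => g (h x)]; rewrite ?inE.
rewrite -sum_nat_const; apply: leq_sum => f _.
have card1 y : y \in [set h x | x in V] -> #|[set f x | x in V & h x == y]| <= 1.
  move=> /imsetP[x _ ->]; rewrite -(cards1 (f x)); apply: subset_leq_card.
  by apply/subsetP => _ /imsetP[x' + ->]; rewrite !inE /= => /eqP/h_inj->.
have := leq_card_ffun_constrained card1.
rewrite exp1n mul1n (card_imset _ h_inj); apply: leq_trans; apply: subset_leq_card.
apply/subsetP => g; rewrite !inE => /eqP <-.
apply/forall_inP => _ /imsetP[x _ ->]; apply/imsetP; exists x; rewrite ?inE ?eqxx //.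
by rewrite ffunE.
Qed.

Lemma leq_card_ffun_pair (I J : finType) (M : {set J * J}) :
  #|[set g : {ffun I -> J} | [exists z : I * I, (z.1 != z.2) && ((g z.1, g z.2) \in M)]]|
    <= #|I| ^ 2 * (#|M| * #|J| ^ (#|I| - 2)).
Proof.
pose F (z : I * I) := [set g : {ffun I -> J} | (g z.1, g z.2) \in M].
apply: (@leq_trans (\sum_(z : I * I | z.1 != z.2) #|F z|)).
  apply: leq_card_cover_family => g; rewrite inE => /existsP[z /andP[neq gM]].
  by exists z; rewrite ?inE.
rewrite -mulnn -card_prod -[leqRHS]sum_nat_const !big_mkcond /=.
apply: leq_sum => -[x y] _ /=.
case: ifP => // neq; pose h (b : bool) := if b then x else y.
pose E := [set f : {ffun bool -> J} | (f true, f false) \in M].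
have h_inj : injective h by case=> -[] //= /eqP; rewrite ?[y == x]eq_sym (negbTE neq).
have -> : F (x, y) = [set g : {ffun I -> J} | [ffun b => g (h b)] \in E].
  by apply/setP => g; rewrite !inE !ffunE.
apply: leq_trans (leq_card_ffun_comp E h_inj) _; rewrite card_bool leq_mul2r.
apply/orP; right; rewrite -(card_in_imset (f := fun f : {ffun bool -> J} => (f true, f false))).
  by apply: subset_leq_card; apply/subsetP => _ /imsetP[f + ->]; rewrite inE.
by move=> f f' _ _ [ft ff]; apply/ffunP => -[].
Qed.

End FiniteCounting.

Section Ramsey.
Local Open Scope nat_scope.

Definition monochromatic (r : nat) (T : finType) (c : T -> T -> 'I_r) (i : 'I_r)
    (B : {set T}) := {in B &, forall x y, x != y -> c x y = i}.

Lemma monochromaticU1 (r : nat) (T : finType) (c : T -> T -> 'I_r) i a (B : {set T}) :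
    (forall x y, c x y = c y x) -> {in B, forall x, c a x = i} -> monochromatic c i B ->
  monochromatic c i (a |: B).
Proof.
move=> c_sym c_a mono_B x y; rewrite !inE => /predU1P[->|xB] /predU1P[->|yB].
- by rewrite eqxx.
- by move=> _; apply: c_a.
- by move=> _; rewrite c_sym; apply: c_a.
- exact: mono_B.
Qed.

Lemma ramsey_multicolour (r : nat) (k : 'I_r -> nat) :
  exists N, forall (T : finType) (c : T -> T -> 'I_r) (A : {set T}),
    (forall x y, c x y = c y x) -> N <= #|A| ->
    exists (i : 'I_r) (B : {set T}), [/\ B \subset A, k i <= #|B| & monochromatic c i B].
Proof.
have [n] := ubnP (\sum_i k i); elim: n k => // n IH k; rewrite ltnS => sum_k.
have [i /eqP ki0|k_gt0] := pickP (fun i => k i == 0).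
  exists 0 => T c A _ _; exists i, set0; rewrite sub0set ki0; split=> // x y.
  by rewrite inE.
pose k' i j := k j - (j == i).
have sum_k' i : \sum_j k' i j < n.
  apply: leq_trans sum_k; rewrite (bigD1 i) //= [X in _ < X](bigD1 i) //= /k' eqxx subn1.
  rewrite (eq_bigr k) => [|j /negbTE->]; last by rewrite subn0.
  by rewrite -addSn prednK // lt0n k_gt0.
have [N ramsey_N] := fin_all_exists (fun i => IH _ (sum_k' i)).
exists (\sum_i N i).+2 => T c A c_sym leA.
have /card_gt0P[a aA] : 0 < #|A| by apply: leq_trans leA.
have [i lt_i] : exists i, N i < #|[set x in A :\ a | c a x == i]|.
  by apply: pigeonhole_fibre; move: leA; rewrite (cardsD1 a A) aA.
have [j [B [sB k_B mono_B]]] := ramsey_N i T c _ c_sym (ltnW lt_i).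
have sBA : B \subset A by apply/subsetP => x /(subsetP sB); rewrite !inE => /andP[/andP[]].
have [eq_ji|neq_ji] := eqVneq j i; last first.
  by exists j, B; move: k_B; rewrite /k' (negbTE neq_ji) subn0.
exists i, (a |: B); subst j; split.
- by rewrite subUset sub1set aA.
- have aB : a \notin B by apply/negP => /(subsetP sB); rewrite !inE eqxx.
  by move: k_B; rewrite /k' eqxx subn1 cardsU1 aB; case: (k i).
- by apply: monochromaticU1 => // x /(subsetP sB); rewrite inE => /andP[_ /eqP].
Qed.

Lemma ramsey_embedding (r : nat) (V : finType) :
  exists m, forall c : 'I_m.+2 -> 'I_m.+2 -> 'I_r, (forall x y, c x y = c y x) ->
    exists (i : 'I_r) (h : {ffun V -> 'I_m.+2}), injective h /\
      forall x y, x != y -> c (h x) (h y) = i.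
Proof.
have [m ramsey_m] := ramsey_multicolour (fun _ : 'I_r => #|V|).
exists m => c c_sym; have [|i [B [_ leB mono_B]]] := ramsey_m _ c setT c_sym.
  by rewrite cardsT card_ord -addn2 leq_addr.
pose h (x : V) := enum_val (widen_ord leB (enum_rank x)).
have h_inj : injective h.
  by move=> x y /enum_val_inj/(congr1 val)/= /val_inj/enum_rank_inj.
exists i, [ffun x => h x]; split=> [x y|x y neq]; rewrite !ffunE; first exact: h_inj.
by apply: mono_B; rewrite ?enum_valP // (inj_eq h_inj).
Qed.

End Ramsey.

Section Embeddings.
Variables (R : realFieldType) (n : nat) (V : finType) (H : sgraph V).
Implicit Types (f : {ffun V -> 'I_n}) (A B C : {set {set 'I_n}}).

Definition pairs : {set {set 'I_n}} := [set e : {set 'I_n} | #|e| == 2%N].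
Definition edge_image f : {set {set 'I_n}} := [set f @: (e : {set V}) | e in edges H].
Definition embeddings C := [set f : {ffun V -> 'I_n} | injectiveb f && (edge_image f \subset C)].
Definition emb_weight A : R :=
  #|[set f : {ffun V -> 'I_n} | injectiveb f && (edge_image f == A)]|%:R.

Lemma sum_emb_weight (P : pred {set {set 'I_n}}) :
  \sum_(A | P A) emb_weight A
  = #|[set f : {ffun V -> 'I_n} | injectiveb f && P (edge_image f)]|%:R.
Proof.
rewrite -natr_sum; congr _%:R; rewrite -[RHS]sum1_card.
rewrite [RHS](partition_big edge_image P) /= => [|f]; last by rewrite inE => /andP[].
apply: eq_bigr => A PA; rewrite -sum1_card; apply: eq_bigl => f; rewrite !inE.
by case: eqP => [->|]; rewrite ?andbF ?PA ?andbT.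
Qed.

Lemma mass_emb_weight C : mass emb_weight C = #|embeddings C|%:R.
Proof. exact: sum_emb_weight (fun A => A \subset C). Qed.

Lemma deg_emb_weight B : deg emb_weight B
  = #|[set f : {ffun V -> 'I_n} | injectiveb f && (B \subset edge_image f)]|%:R.
Proof. exact: sum_emb_weight (fun A => B \subset A). Qed.

Lemma emb_weight_ge0 : weight emb_weight.
Proof. by move=> A; apply: ler0n. Qed.

Lemma card_edge (e : {set V}) : e \in edges H -> #|e| = 2%N.
Proof. by move=> eH; apply/eqP; have /forall_inP := edgesP H; apply. Qed.

Lemma card_edge_image f : injective f -> #|edge_image f| = #|edges H|.
Proof. by move=> f_inj; rewrite card_imset //; apply: imset_inj. Qed.

Lemma edge_image_pairs f : injective f -> edge_image f \subset pairs.
Proof.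
move=> f_inj; apply/subsetP => _ /imsetP[e eH ->].
by rewrite inE card_imset // card_edge.
Qed.

Lemma uniform_emb_weight : uniform emb_weight #|edges H| pairs.
Proof.
move=> A; rewrite pnatr_eq0 -lt0n => /card_gt0P[f].
by rewrite inE => /andP[/injectiveP f_inj /eqP <-]; rewrite card_edge_image ?edge_image_pairs.
Qed.

End Embeddings.

Section Supersaturation.
Variables (r : nat) (V : finType) (H : sgraph V).

Definition uncovered n (C : 'I_r -> {set {set 'I_n}}) := pairs n :\: \bigcup_i C i.

Definition degenerate n (C : 'I_r -> {set {set 'I_n}}) :=
  [set z : 'I_n * 'I_n | (z.1 == z.2) || ([set z.1; z.2] \in uncovered C)].

Lemma card_ordered_pairs_le (T : finType) (D : {set {set T}}) :
  (#|[set z : T * T | (z.1 != z.2) && ([set z.1; z.2] \in D)]| <= 2 * #|D|)%N.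
Proof.
pose F (e : {set T}) := [set z : T * T | (z.1 != z.2) && ([set z.1; z.2] == e)].
apply: (@leq_trans (\sum_(e in D) #|F e|)).
  apply: leq_card_cover_family => z; rewrite inE => /andP[neq zD].
  by exists [set z.1; z.2]; rewrite // inE neq /=.
rewrite mulnC -sum_nat_const; apply: leq_sum => e _.
have [->|[[a b]]] := set_0Vmem (F e); first by rewrite cards0.
rewrite inE /= => /andP[_ /eqP eE].
apply: (@leq_trans #|[set (a, b); (b, a)]|); last by rewrite cards2; case: eqP.
apply: subset_leq_card; apply/subsetP => -[x y].
rewrite !inE /= -eE => /andP[neq /eqP exy].
have: x \in [set a; b] by rewrite -exy !inE eqxx.
have: y \in [set a; b] by rewrite -exy !inE eqxx orbT.
rewrite !inE !xpair_eqE => /orP[]/eqP yE /orP[]/eqP xE; move: neq;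
  by rewrite xE yE !eqxx ?orbT.
Qed.

Lemma card_degenerate_le n (C : 'I_r -> {set {set 'I_n}}) :
  (#|degenerate C| <= n + 2 * #|uncovered C|)%N.
Proof.
have -> : degenerate C = [set (x, x) | x : 'I_n] :|:
    [set z : 'I_n * 'I_n | (z.1 != z.2) && ([set z.1; z.2] \in uncovered C)].
  apply/setP => -[x y]; rewrite !inE /=; have [->|neq] /= := eqVneq x y.
    by rewrite orbF; apply/esym/imsetP; exists y.
  by case: imsetP => // -[z _ [eq_xz eq_yz]]; rewrite eq_xz eq_yz eqxx in neq.
apply: leq_trans (leq_card_setU _ _) (leq_add _ (card_ordered_pairs_le _)).
by apply: leq_trans (leq_imset_card _ _) _; rewrite card_ord.
Qed.

(* Unless g meets a degenerate pair, the sets C i pull back along g to a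
   colouring of the complete graph. *)
Lemma ramsey_degenerate_or_embedding : exists m, forall n (C : 'I_r -> {set {set 'I_n}})
    (g : {ffun 'I_m.+2 -> 'I_n}),
  [exists z : 'I_m.+2 * 'I_m.+2, (z.1 != z.2) && ((g z.1, g z.2) \in degenerate C)] \/
  exists i (h : {ffun V -> 'I_m.+2}),
    injective h /\ [ffun x => g (h x)] \in embeddings H (C i).
Proof.
have [m ramsey_m] := ramsey_embedding r V; exists m => n C g.
case: existsP => [_|nondeg]; [by left | right].
have coloured_pair x y : x != y -> g x != g y /\ exists i, [set g x; g y] \in C i.
  move=> neq; have : (g x, g y) \notin degenerate C.
    by apply/negP => bad; apply: nondeg; exists (x, y); rewrite neq.
  rewrite !inE /= negb_or cards2 => /andP[neq_g]; rewrite neq_g eqxx andbT negbK.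
  by move=> /bigcupP[i _ iC]; split=> //; exists i.
have [_ [i0 _]] := coloured_pair ord0 ord_max isT.
pose c x y := odflt i0 [pick i | [set g x; g y] \in C i].
have [|i [h [h_inj c_h]]] := ramsey_m c; first by move=> x y; rewrite /c setUC.
exists i, h; split=> //; rewrite inE; apply/andP; split.
  apply/injectiveP => x y; rewrite !ffunE; apply: contra_eq => neq.
  by have [|] := coloured_pair (h x) (h y); rewrite ?(inj_eq h_inj).
apply/subsetP => _ /imsetP[e /(@card_edge _ H)/eqP/cards2P[x [y [neq ->]]] ->].
rewrite imsetU1 imset_set1 !ffunE -(c_h x y neq) /c.
have [|_ [j jC]] := coloured_pair (h x) (h y); first by rewrite (inj_eq h_inj).
by case: pickP => [//|/(_ j)]; rewrite jC.
Qed.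

Lemma ramsey_count : exists m, forall n (C : 'I_r -> {set {set 'I_n}}),
  (n ^ m.+2 <= m.+2 ^ 2 * (#|degenerate C| * n ^ m) +
    \sum_(ih : 'I_r * {ffun V -> 'I_m.+2} | injectiveb ih.2)
      #|embeddings H (C ih.1)| * n ^ (m.+2 - #|V|))%N.
Proof.
have [m ramsey_m] := ramsey_degenerate_or_embedding; exists m => n C.
pose bad := [set g : {ffun 'I_m.+2 -> 'I_n} |
  [exists z : 'I_m.+2 * 'I_m.+2, (z.1 != z.2) && ((g z.1, g z.2) \in degenerate C)]].
pose F (ih : 'I_r * {ffun V -> 'I_m.+2}) :=
  [set g : {ffun 'I_m.+2 -> 'I_n} | [ffun x => g (ih.2 x)] \in embeddings H (C ih.1)].
have -> : (n ^ m.+2 = #|bad| + #|~: bad|)%N by rewrite cardsC card_ffun !card_ord.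
apply: leq_add.
  by have := leq_card_ffun_pair 'I_m.+2 (degenerate C); rewrite !card_ord subSS subSS subn0.
apply: (@leq_trans (\sum_(ih : 'I_r * {ffun V -> 'I_m.+2} | injectiveb ih.2) #|F ih|)%N).
  apply: leq_card_cover_family => g; rewrite !inE => nbad.
  have [bad_g|[i [h [h_inj emb]]]] := ramsey_m n C g; first by rewrite bad_g in nbad.
  by exists (i, h); [apply/injectiveP | rewrite inE].
apply: leq_sum => -[i h] /injectiveP /= h_inj.
by have := leq_card_ffun_comp (embeddings H (C i)) h_inj; rewrite !card_ord.
Qed.

Lemma sum_embeddings_le (R : realFieldType) (m n : nat) (C : 'I_r -> {set {set 'I_n}}) (y : R) :
    0 <= y -> (forall i, mass (emb_weight R H) (C i) <= y * n%:R ^+ #|V|) ->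
  (\sum_(ih : 'I_r * {ffun V -> 'I_m} | injectiveb ih.2)
      #|embeddings H (C ih.1)| * n ^ (m - #|V|))%N%:R
    <= r%:R * m%:R ^+ #|V| * y * n%:R ^+ m.
Proof.
move=> y_ge0 few; have yn_ge0 : 0 <= y * n%:R ^+ m by rewrite mulr_ge0 ?exprn_ge0.
apply: (@le_trans _ _ (\sum_(ih : 'I_r * {ffun V -> 'I_m}) y * n%:R ^+ m)).
  rewrite natr_sum big_mkcond; apply: ler_sum => -[i h] _ /=.
  case: ifP => // /injectiveP h_inj; rewrite natrM natrX -mass_emb_weight.
  have leV : (#|V| <= m)%N by have := leq_card h h_inj; rewrite card_ord.
  by rewrite -[in leRHS](subnKC leV) exprD [leRHS]mulrA ler_wpM2r ?exprn_ge0.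
by rewrite sumr_const card_prod card_ffun !card_ord -[leLHS]mulr_natl natrM natrX mulrA.
Qed.

Lemma supersaturation (R : realFieldType) :
  exists (eps delta : R) (n0 : nat), [/\ 0 < eps, 0 < delta &
    forall n (C : 'I_r -> {set {set 'I_n}}), (n0 <= n)%N ->
    (forall i, mass (emb_weight R H) (C i) < eps * n%:R ^+ #|V|) ->
    delta * n%:R ^+ 2 <= #|uncovered C|%:R].
Proof.
have [m count] := ramsey_count.
pose t : R := m.+2%:R; pose s : R := r.+1%:R.
have t_gt0 : 0 < t by rewrite ltr0n.
have s_gt0 : 0 < s by rewrite ltr0n.
exists (4 * t ^+ #|V| * s)^-1, (4 * t ^+ 2)^-1, (4 * m.+2 ^ 2).+1.
split=> [||n C n_large few]; first by rewrite invr_gt0 !mulr_gt0 // exprn_gt0.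
  by rewrite invr_gt0 mulr_gt0 // exprn_gt0.
pose x : R := n%:R; have x_gt0 : 0 < x by rewrite ltr0n (leq_trans _ n_large).
have xm_gt0 : 0 < x ^+ m by apply: exprn_gt0.
have t2_gt0 : 0 < t ^+ 2 by apply: exprn_gt0.
have eps_ge0 : 0 <= (4 * t ^+ #|V| * s)^-1 by rewrite invr_ge0 !mulr_ge0 ?exprn_ge0 // ltW.
have embeddings_few := sum_embeddings_le m.+2 eps_ge0 (fun i => ltW (few i)).
have quarter : r%:R * t ^+ #|V| * (4 * t ^+ #|V| * s)^-1 <= 1 / 4.
  have -> : r%:R * t ^+ #|V| * (4 * t ^+ #|V| * s)^-1 = r%:R / s / 4.
    have : 0 < t ^+ #|V| by apply: exprn_gt0.
    move: (t ^+ #|V|) (s) s_gt0 => y z z_gt0 y_gt0.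
    by field; rewrite !gt_eqF.
  by rewrite ler_pM2r ?invr_gt0 // ler_pdivrMr // mul1r ler_nat.
have degenerate_le : #|degenerate C|%:R <= x + 2 * #|uncovered C|%:R.
  by rewrite -natrM -natrD ler_nat card_degenerate_le.
have x_large : 4 * t ^+ 2 * x <= x ^+ 2.
  by rewrite [x ^+ 2]expr2 ler_pM2r // /t -natrX -natrM ler_nat ltnW.
have : x ^+ m.+2 <= t ^+ 2 * (#|degenerate C|%:R * x ^+ m) + 1 / 4 * x ^+ m.+2.
  move: (count n C); rewrite -(ler_nat R) natrD !(natrM, natrX) => /le_trans; apply.
  by rewrite lerD2l (le_trans embeddings_few) // ler_pM2r // exprn_gt0.
have -> : x ^+ m.+2 = x ^+ 2 * x ^+ m by rewrite -exprD.
rewrite [X in X + _]mulrA [X in _ + X]mulrA -mulrDl ler_pM2r // => count_le.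
rewrite ler_pdivrMl ?mulr_gt0 //.
have := ler_wpM2l (ltW t2_gt0) degenerate_le.
rewrite -/x; lra.
Qed.

End Supersaturation.

(** * The binomial random graph *)

Lemma sum_subset_prod (R : comPzRingType) (T : finType) (S : {set T}) (a b : T -> R) :
  \sum_(E : {set T} | E \subset S) \prod_(e in S) (if e \in E then a e else b e)
  = \prod_(e in S) (a e + b e).
Proof.
pose a' e := if e \in S then a e else 0; pose b' e := if e \in S then b e else 1.
have -> : \prod_(e in S) (a e + b e) = \prod_e (a' e + b' e).
  rewrite big_mkcond; apply: eq_bigr => e _; rewrite /a' /b'.
  by case: ifP => _; rewrite ?add0r.
rewrite bigA_distr big_mkcond; apply: eq_bigr => E _; case: ifP => [sES|].
  rewrite big_mkcond; apply: eq_bigr => e _; rewrite /a' /b'.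
  by case: (boolP (e \in S)) => // eS; rewrite (contraNF (subsetP sES e)).
move/negbT/subsetPn => [e eE eS].
by rewrite (bigD1 e) //= eE /a' (negbTE eS) mul0r.
Qed.

Section PartialColourings.
Variables (R : comPzRingType) (T : finType) (r : nat).
Implicit Type kappa : {ffun T -> option 'I_r}.

Definition colour_class kappa i := [set x | kappa x == Some i].
Definition coloured kappa := [set x | kappa x != None].

Lemma card_coloured_le kappa : (#|coloured kappa| <= \sum_i #|colour_class kappa i|)%N.
Proof.
apply: leq_card_cover_family => x; rewrite inE.
by case E: (kappa x) => [i|//] _; exists i; rewrite ?inE ?E.
Qed.

Lemma sum_partial_colourings (S : {set T}) (y : R) :
  \sum_(kappa | coloured kappa \subset S) y ^+ #|coloured kappa| = (1 + r%:R * y) ^+ #|S|.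
Proof.
pose F (x : T) (o : option 'I_r) : R := if o is None then 1 else if x \in S then y else 0.
transitivity (\sum_(kappa : {ffun T -> option 'I_r}) \prod_x F x (kappa x)).
  rewrite big_mkcond; apply: eq_bigr => kappa _; case: ifP => [sS|/negbT/subsetPn[x]].
    rewrite -prodr_const big_mkcond; apply: eq_bigr => x _; rewrite /F inE.
    case E: (kappa x) => [i|] //=.
    by rewrite (subsetP sS) // inE E.
  by rewrite inE (bigD1 x) //= /F; case: (kappa x) => // i _ /negbTE->; rewrite mul0r.
rewrite -(bigA_distr_bigA F) -prodr_const [RHS]big_mkcond; apply: eq_bigr => x _.
rewrite (bigD1 None) //= (eq_bigr (fun=> if x \in S then y else 0)) => [|[]] //.
rewrite sumr_const cardC1 card_option card_ord /=.
by case: ifP; rewrite ?mul0rn ?addr0 // mulr_natl.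
Qed.

End PartialColourings.

Section RandomGraph.
Variables (R : realType) (n : nat) (p : R).
Hypothesis p01 : 0 <= p <= 1.
Implicit Types (G : sgraph 'I_n) (E U C S : {set {set 'I_n}}).

Let p_ge0 : 0 <= p. Proof. by case/andP: p01. Qed.
Let p_le1 : p <= 1. Proof. by case/andP: p01. Qed.

Lemma edges_sub_pairs G : edges G \subset pairs n.
Proof. by apply/subsetP => e eG; rewrite inE (card_edge eG). Qed.

Lemma sum_sgraph (F : {set {set 'I_n}} -> R) :
  \sum_(G : sgraph 'I_n) F (edges G) = \sum_(E : {set {set 'I_n}} | E \subset pairs n) F E.
Proof.
rewrite [RHS](reindex_omap (fun G : sgraph 'I_n => edges G) (fun E => insub E)) /=.
  by apply: eq_bigl => G; rewrite edges_sub_pairs valK eqxx.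
move=> E sE; case: insubP => [G _ <- //|]; case/negP; apply/forall_inP => e /(subsetP sE).
by rewrite inE.
Qed.

Lemma Gnp_massE G :
  Gnp_mass p G = \prod_(e in pairs n) (if e \in edges G then p else 1 - p).
Proof. by apply: eq_bigl => e; rewrite inE. Qed.

Lemma Gnp_mass_ge0 G : 0 <= Gnp_mass p G.
Proof. by apply: prodr_ge0 => e _; case: ifP => _; rewrite ?subr_ge0. Qed.

Lemma Gnp_prob_interval U C : U \subset pairs n -> U \subset C ->
  Gnp_prob p (fun G => (U \subset edges G) && (edges G \subset C))
  = p ^+ #|U| * (1 - p) ^+ #|pairs n :\: C|.
Proof.
move=> sUS sUC; rewrite /Gnp_prob big_mkcond /=.
pose a (e : {set 'I_n}) := if e \in C then p else 0.
pose b (e : {set 'I_n}) := if e \in U then 0 else 1 - p.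
transitivity (\sum_(G : sgraph 'I_n)
    \prod_(e in pairs n) (if e \in edges G then a e else b e)).
  apply: eq_bigr => G _; rewrite Gnp_massE; case: ifP => [/andP[sUG sGC]|].
    apply: eq_bigr => e _; rewrite /a /b; case: (boolP (e \in edges G)) => eG.
      by rewrite (subsetP sGC).
    by rewrite (contraNF (subsetP sUG e)).
  move/negbT; rewrite negb_and => /orP[]/subsetPn[e e_in e_out]; apply/esym.
    by rewrite (bigD1 e) ?(subsetP sUS) //= (negbTE e_out) /b e_in mul0r.
  by rewrite (bigD1 e) ?(subsetP (edges_sub_pairs G)) //= e_in /a (negbTE e_out) mul0r.
rewrite (sum_sgraph (fun E => \prod_(e in pairs n) (if e \in E then a e else b e))).
rewrite sum_subset_prod.
rewrite (eq_bigr (fun e => (if e \in U then p else 1) * (if e \notin C then 1 - p else 1))).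
  rewrite big_split /= -!big_mkcondr -!prodr_const /=; congr (_ * _); apply: eq_bigl => e.
    by case: (boolP (e \in U)) => eU; rewrite ?andbF // (subsetP sUS).
  by rewrite in_setD andbC.
move=> e _; rewrite /a /b; case: (boolP (e \in U)) => eU.
  by rewrite (subsetP sUC) // addr0 mulr1.
by case: (e \in C); rewrite mul1r ?add0r // addrC subrK.
Qed.

Lemma Gnp_prob_sup U : U \subset pairs n -> Gnp_prob p (fun G => U \subset edges G) = p ^+ #|U|.
Proof.
move=> sU; have := Gnp_prob_interval sU (subsetT U); rewrite setDT cards0 expr0 mulr1 => <-.
by apply: eq_bigl => G; rewrite subsetT andbT.
Qed.

Lemma Gnp_mass_sum : \sum_(G : sgraph 'I_n) Gnp_mass p G = 1.
Proof.
have := Gnp_prob_sup (sub0set _); rewrite cards0 expr0 => <-.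
by apply: eq_bigl => G; rewrite sub0set.
Qed.

Lemma Gnp_prob_compl (A : pred (sgraph 'I_n)) :
  Gnp_prob p A = 1 - Gnp_prob p (fun G => ~~ A G).
Proof. by rewrite -Gnp_mass_sum (bigID A) /= addrK. Qed.

Lemma Gnp_prob_le1 (A : pred (sgraph 'I_n)) : Gnp_prob p A <= 1.
Proof.
by rewrite Gnp_prob_compl lerBlDr lerDl sumr_ge0 // => G _; apply: Gnp_mass_ge0.
Qed.

Lemma Gnp_prob_subset (A B : pred (sgraph 'I_n)) : (forall G, A G -> B G) ->
  Gnp_prob p A <= Gnp_prob p B.
Proof.
move=> sAB; rewrite /Gnp_prob [leLHS]big_mkcond [leRHS]big_mkcond; apply: ler_sum => G _.
by case: ifP => [/sAB->//|_]; case: ifP => // _; apply: Gnp_mass_ge0.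
Qed.

Lemma Gnp_prob_union_le (A B : pred (sgraph 'I_n)) :
  Gnp_prob p (fun G => A G || B G) <= Gnp_prob p A + Gnp_prob p B.
Proof.
rewrite /Gnp_prob big_mkcond [X in X + _]big_mkcond [X in _ + X]big_mkcond -big_split.
apply: ler_sum => G _ /=.
by have := Gnp_mass_ge0 G; case: (A G); case: (B G) => /=; lra.
Qed.

Lemma Gnp_prob_exists_le (I : finType) (A : I -> pred (sgraph 'I_n)) (P : pred I) :
  Gnp_prob p (fun G => [exists i, P i && A i G]) <= \sum_(i | P i) Gnp_prob p (A i).
Proof.
rewrite /Gnp_prob [leRHS](eq_bigr (fun i => \sum_G (if A i G then Gnp_mass p G else 0))).
  rewrite exchange_big [leLHS]big_mkcond; apply: ler_sum => G _ /=.
  have term_ge0 i : 0 <= (if A i G then Gnp_mass p G else 0).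
    by case: ifP => // _; apply: Gnp_mass_ge0.
  case: ifP => [/existsP[i /andP[Pi Ai]]|_]; last exact: sumr_ge0.
  by rewrite (bigD1 i) //= Ai lerDl sumr_ge0.
by move=> i _; rewrite big_mkcond.
Qed.

Definition Gnp_expect (F : sgraph 'I_n -> R) := \sum_(G : sgraph 'I_n) Gnp_mass p G * F G.

Lemma Gnp_expect_sup U : U \subset pairs n ->
  Gnp_expect (fun G => (U \subset edges G)%:R) = p ^+ #|U|.
Proof.
move=> sU; rewrite -Gnp_prob_sup // /Gnp_prob [RHS]big_mkcond.
by apply: eq_bigr => G _; case: ifP; rewrite ?mulr1 ?mulr0.
Qed.

Lemma Gnp_expect_sum (I : finType) (a : I -> R) (F : I -> sgraph 'I_n -> R) :
  Gnp_expect (fun G => \sum_i a i * F i G) = \sum_i a i * Gnp_expect (F i).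
Proof.
rewrite /Gnp_expect; under eq_bigr do rewrite mulr_sumr.
rewrite exchange_big; apply: eq_bigr => i _; rewrite mulr_sumr.
by apply: eq_bigr => G _; rewrite mulrCA.
Qed.

Lemma Gnp_chebyshev (F : sgraph 'I_n -> R) (a : R) : 0 < a ->
  Gnp_prob p (fun G => Gnp_expect F + a <= F G)
    <= (Gnp_expect (fun G => F G ^+ 2) - Gnp_expect F ^+ 2) / a ^+ 2.
Proof.
move=> a_gt0; rewrite ler_pdivlMr ?exprn_gt0 //; set mu := Gnp_expect F.
have -> : Gnp_expect (fun G => F G ^+ 2) - mu ^+ 2 = Gnp_expect (fun G => (F G - mu) ^+ 2).
  have -> : Gnp_expect (fun G => F G ^+ 2) - mu ^+ 2 = Gnp_expect (fun G => F G ^+ 2)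
      - 2 * mu * Gnp_expect F + mu ^+ 2 * \sum_(G : sgraph 'I_n) Gnp_mass p G.
    by rewrite Gnp_mass_sum -/mu; ring.
  move: (mu) => m; rewrite /Gnp_expect !mulr_sumr -sumrB -big_split.
  by apply: eq_bigr => G _ /=; ring.
rewrite /Gnp_prob big_mkcond mulr_suml; apply: ler_sum => G _.
case: ifP => [le_a|_]; last by rewrite mul0r mulr_ge0 ?Gnp_mass_ge0 ?sqr_ge0.
by apply: ler_wpM2l; rewrite ?Gnp_mass_ge0 // ler_sqr ?nnegrE; lra.
Qed.

Section SecondMoment.
Variables (k : nat) (w : {set {set 'I_n}} -> R) (K M : R).
Hypotheses (K_ge0 : 0 <= K) (M_ge0 : 0 <= M) (w_spread : spread w k (pairs n) K p M).

Let w_ge0 : weight w. Proof. by case: w_spread. Qed.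
Let w_uniform : uniform w k (pairs n). Proof. by case: w_spread. Qed.

Lemma Gnp_expect_mass : Gnp_expect (fun G => mass w (edges G)) = (\sum_A w A) * p ^+ k.
Proof.
transitivity (Gnp_expect (fun G => \sum_A w A * (A \subset edges G)%:R)).
  by apply: eq_bigr => G _; rewrite massE.
rewrite Gnp_expect_sum mulr_suml; apply: eq_bigr => A _.
have [->|/w_uniform[<- sA]] := eqVneq (w A) 0; first by rewrite !mul0r.
by rewrite Gnp_expect_sup.
Qed.

Lemma Gnp_expect_mass_sq : Gnp_expect (fun G => mass w (edges G) ^+ 2)
  = \sum_A w A * \sum_B w B * p ^+ #|A :|: B|.
Proof.
transitivity (Gnp_expect (fun G =>
    \sum_A w A * \sum_B w B * (A :|: B \subset edges G)%:R)).
  apply: eq_bigr => G _; congr (_ * _); rewrite massE expr2 big_distrlr.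
  apply: eq_bigr => A _; rewrite mulr_sumr; apply: eq_bigr => B _.
  by rewrite /= subUset -mulnb natrM; ring.
rewrite Gnp_expect_sum; apply: eq_bigr => A _.
have [->|/w_uniform[_ sA]] := eqVneq (w A) 0; first by rewrite !mul0r.
rewrite Gnp_expect_sum; congr (_ * _); apply: eq_bigr => B _.
have [->|/w_uniform[_ sB]] := eqVneq (w B) 0; first by rewrite !mul0r.
by rewrite Gnp_expect_sup // subUset sA.
Qed.

Lemma sum_expr_cardU_le (A : {set {set 'I_n}}) : #|A| = k ->
  \sum_B w B * p ^+ #|A :|: B|
    <= (\sum_B w B) * p ^+ (2 * k) + 2 ^+ k * (K * (p ^+ (2 * k).-1 * M)).
Proof.
move=> cardA.
have cardU B : w B * p ^+ #|A :|: B| = w B * p ^+ (2 * k - #|A :&: B|).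
  have [->|/w_uniform[cardB _]] := eqVneq (w B) 0; first by rewrite !mul0r.
  by rewrite cardsU cardA cardB mul2n addnn.
under eq_bigr do rewrite cardU.
rewrite (partition_big (fun B => A :&: B) (mem (powerset A))) /= => [|B _]; last first.
  by rewrite powersetE subsetIl.
rewrite (bigD1 set0) ?powersetE ?sub0set //=; apply: lerD.
  rewrite mulr_suml [leLHS]big_mkcond; apply: ler_sum => B _.
  by case: eqP => [->|_]; rewrite ?cards0 ?subn0 // mulr_ge0 ?exprn_ge0.
apply: (@le_trans _ _ (\sum_(D in powerset A) K * (p ^+ (2 * k).-1 * M))); last first.
  by rewrite sumr_const card_powerset cardA -[leLHS]mulr_natl natrX.
rewrite big_mkcondr; apply: ler_sum => D; rewrite powersetE => sDA.
case: ifP => D_neq0; last by rewrite !mulr_ge0 ?exprn_ge0.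
apply: (@le_trans _ _ (deg w D * p ^+ (2 * k - #|D|))).
  rewrite /deg mulr_suml big_mkcond [leRHS]big_mkcond; apply: ler_sum => B _.
  case: eqP => [eq_D|_]; first by rewrite eq_D ifT // -eq_D subsetIr.
  by case: ifP => // _; rewrite mulr_ge0 ?exprn_ge0.
have [_ _ /(_ D D_neq0) deg_D] := w_spread.
apply: le_trans (ler_wpM2r (exprn_ge0 _ p_ge0) deg_D) _.
have D_gt0 : (0 < #|D|)%N by rewrite card_gt0.
have leD : (#|D| <= 2 * k)%N by rewrite -cardA (leq_trans (subset_leq_card sDA)) ?leq_pmull.
have -> : (2 * k).-1 = (#|D|.-1 + (2 * k - #|D|))%N by rewrite -{1}(subnKC leD); case: #|D| D_gt0.
by rewrite exprD -!mulrA [M * _]mulrC.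
Qed.

Lemma mass_upper_tail (a : R) : 0 < a ->
  Gnp_prob p (fun G => (\sum_A w A) * p ^+ k + a <= mass w (edges G))
    <= (\sum_A w A) * (2 ^+ k * (K * (p ^+ (2 * k).-1 * M))) / a ^+ 2.
Proof.
move=> a_gt0; rewrite -Gnp_expect_mass.
apply: le_trans (Gnp_chebyshev _ a_gt0) _; rewrite ler_pM2r ?invr_gt0 ?exprn_gt0 //.
rewrite lerBlDl Gnp_expect_mass Gnp_expect_mass_sq exprMn -exprM [(k * 2)%N]mulnC expr2 -!mulrA.
rewrite -mulrDr [leRHS]mulr_suml; apply: ler_sum => A _.
have [->|/w_uniform[cardA _]] := eqVneq (w A) 0; first by rewrite !mul0r.
by apply: ler_wpM2l => //; apply: sum_expr_cardU_le.
Qed.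

End SecondMoment.

Section FingerprintUnionBound.
Variables (r : nat) (C : {set {set 'I_n}} -> {set {set 'I_n}}).
Implicit Type kappa : {ffun {set 'I_n} -> option 'I_r}.

Definition covered kappa := \bigcup_i C (colour_class kappa i).
Definition captures kappa G :=
  (coloured kappa \subset edges G) && (edges G \subset covered kappa).

Lemma Gnp_prob_captures_le kappa : Gnp_prob p (captures kappa) <=
  if coloured kappa \subset pairs n
  then p ^+ #|coloured kappa| * expR (- p * #|pairs n :\: covered kappa|%:R) else 0.
Proof.
have captures0 : (forall G, ~~ captures kappa G) -> Gnp_prob p (captures kappa) = 0.
  by move=> none; rewrite /Gnp_prob big_pred0 // => G; apply: negbTE.
case: ifP => [sP|/negbT sP]; last first.
  rewrite captures0 // => G; apply: contra sP => /andP[sG _].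
  exact: subset_trans sG (edges_sub_pairs G).
have bound_ge0 : 0 <= p ^+ #|coloured kappa| * expR (- p * #|pairs n :\: covered kappa|%:R).
  by rewrite mulr_ge0 ?exprn_ge0 ?expR_ge0.
have [sC|sC] := boolP (coloured kappa \subset covered kappa); last first.
  by rewrite captures0 // => G; apply: contra sC => /andP[]; apply: subset_trans.
rewrite Gnp_prob_interval // ler_wpM2l ?exprn_ge0 // mulrC expRM_natl.
by apply: lerXn2r; rewrite ?nnegrE ?subr_ge0 ?expR_ge0 // expR_ge1Dx.
Qed.

Definition captured (t m : R) G := [exists kappa,
  (#|coloured kappa|%:R <= t) && (m <= #|pairs n :\: covered kappa|%:R) && captures kappa G].

(* Each fingerprint of size at most t is given the extra factor
   expR (a * (t - #|coloured kappa|)) >= 1, which turns the sum over the small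
   fingerprints into a full product over the pairs. *)
Lemma Gnp_prob_captured_le (a t m : R) : 0 <= a ->
  Gnp_prob p (captured t m)
    <= expR (a * t + r%:R * p * expR (- a) * #|pairs n|%:R - p * m).
Proof.
move=> a_ge0; apply: le_trans (Gnp_prob_exists_le _ _) _.
apply: (@le_trans _ _ (\sum_(kappa | coloured kappa \subset pairs n)
    (p * expR (- a)) ^+ #|coloured kappa| * expR (a * t - p * m))).
  rewrite big_mkcond [leRHS]big_mkcond; apply: ler_sum => kappa _.
  have term_ge0 : 0 <= (p * expR (- a)) ^+ #|coloured kappa| * expR (a * t - p * m).
    by rewrite mulr_ge0 ?expR_ge0 // exprn_ge0 // mulr_ge0 ?expR_ge0.
  case: ifP => [/andP[le_t le_m]|_]; last by case: ifP.
  apply: le_trans (Gnp_prob_captures_le kappa) _; case: ifP => // _.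
  rewrite exprMn -mulrA ler_wpM2l ?exprn_ge0 // -expRM_natl -expRD ler_expR.
  rewrite mulNr mulrN addrA -[leLHS]add0r lerD ?lerN2 ?ler_wpM2l //.
  by rewrite addrC subr_ge0 [_ * a]mulrC ler_wpM2l.
rewrite -mulr_suml sum_partial_colourings addrAC [leRHS]expRD [leRHS]mulrC ler_wpM2r ?expR_ge0 //.
rewrite [_ * #|_|%:R]mulrC expRM_natl -mulrA.
apply: lerXn2r; rewrite ?nnegrE ?expR_ge0 ?expR_ge1Dx //.
by rewrite addr_ge0 // !mulr_ge0 ?expR_ge0.
Qed.

End FingerprintUnionBound.
End RandomGraph.

(** * Densities and copies *)

Section GraphParameters.
Variables (R : realType) (V : finType) (H : sgraph V).

Lemma card_cover_edges (J : {set {set V}}) : J \subset edges H -> J != set0 ->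
  (2 <= #|cover J|)%N.
Proof.
move=> sJ /set0Pn[e eJ]; rewrite -(card_edge (subsetP sJ _ eJ)).
by apply: subset_leq_card; apply: (bigcup_sup e).
Qed.

Lemma card_cover_edges_gt2 (J : {set {set V}}) : J \subset edges H -> (1 < #|J|)%N ->
  (2 < #|cover J|)%N.
Proof.
move=> sJ /card_gt1P[e [e' [eJ e'J neq]]].
rewrite ltn_neqAle eq_sym (card_cover_edges sJ) ?andbT; last by apply/set0Pn; exists e.
apply: contra neq => /eqP card_cover.
have edge_cover (d : {set V}) : d \in J -> d = cover J.
  move=> dJ; apply/eqP; rewrite eqEcard card_cover (card_edge (subsetP sJ _ dJ)) leqnn andbT.
  exact: (bigcup_sup d).
by rewrite (edge_cover e) // (edge_cover e').
Qed.

Lemma d2_le_m2 (J : {set {set V}}) : J \subset edges H -> (1 < #|J|)%N ->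
  #|J|%:R - 1 <= m2 R H * (#|cover J|%:R - 2).
Proof.
move=> sJ J_gt1; have cover_gt2 := card_cover_edges_gt2 sJ J_gt1.
rewrite -ler_pdivrMr ?subr_gt0 ?ltr_nat //.
have <- : d2 R (cover J, J) = (#|J|%:R - 1) / (#|cover J|%:R - 2).
  by rewrite /d2 /= gtn_eqF.
rewrite /m2; apply: le_bigmax_cond.
by rewrite inE /= sJ (ltnW J_gt1) andbT; apply/forall_inP => e eJ; apply: (bigcup_sup e).
Qed.

Hypothesis hH : (2 <= maxdeg H)%N.

Lemma maxdeg_cherry : exists J : {set {set V}},
  [/\ J \subset edges H, #|J| = 2%N & (#|cover J| <= 3)%N].
Proof.
have /existsP[v] : [exists v : V, 2 <= #|[set e in edges H | v \in e]|]%N.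
  apply: contraTT hH; rewrite negb_exists -ltnNge ltnS => /forallP deg_le1.
  by apply/bigmax_leqP => v _; have := deg_le1 v; rewrite -ltnNge.
move=> /card_gt1P[e [e' []]]; rewrite !inE => /andP[eH ve] /andP[e'H ve'] neq.
exists [set e; e']; split; first by rewrite subUset !sub1set eH.
  by rewrite cards2 neq.
rewrite /cover bigcup_setU !big_set1 cardsU (card_edge eH) (card_edge e'H).
have : (0 < #|e :&: e'|)%N by apply/card_gt0P; exists v; rewrite inE ve.
by case: #|e :&: e'| => // m _; rewrite subSS leq_subr.
Qed.

Lemma m2_ge1 : 1 <= m2 R H.
Proof.
have [J [sJ cardJ cover_le3]] := maxdeg_cherry.
have J_gt1 : (1 < #|J|)%N by rewrite cardJ.
have cover3 : #|cover J| = 3%N by apply/eqP; rewrite eqn_leq cover_le3 card_cover_edges_gt2.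
by have := d2_le_m2 sJ J_gt1; rewrite cardJ cover3; lra.
Qed.

Lemma card_edges_gt0 : (0 < #|edges H|)%N.
Proof.
have [J [sJ cardJ _]] := maxdeg_cherry.
by apply: leq_trans (subset_leq_card sJ); rewrite cardJ.
Qed.

Lemma card_vertices_ge2 : (2 <= #|V|)%N.
Proof.
have [J [sJ cardJ _]] := maxdeg_cherry; apply: leq_trans (max_card (cover J)).
by apply: card_cover_edges sJ _; rewrite -card_gt0 cardJ.
Qed.

Definition threshold (n : nat) : R := n%:R `^ (- (1 / m2 R H)).

Lemma threshold_gt0 n : (0 < n)%N -> 0 < threshold n.
Proof. by move=> n_gt0; rewrite powR_gt0 // ltr0n. Qed.

Lemma mulr_ge1_threshold n (q : R) : (0 < n)%N -> threshold n <= q -> 1 <= q * n%:R.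
Proof.
move=> n_gt0 le_q; have m2_gt0 : 0 < m2 R H := lt_le_trans ltr01 m2_ge1.
have inv_mul : n%:R `^ (- 1) * n%:R = 1 :> R by rewrite powR_inv1 // mulVf // pnatr_eq0 -lt0n.
rewrite -[leLHS]inv_mul; apply: ler_wpM2r => //; apply: le_trans le_q.
apply: ler_powR; first by rewrite ler1n.
by rewrite lerN2 div1r invf_le1 // m2_ge1.
Qed.

Lemma subgraph_expectation_ge1 (n : nat) (q : R) (J : {set {set V}}) : (0 < n)%N ->
    threshold n <= q -> J \subset edges H -> J != set0 ->
  1 <= n%:R ^+ (#|cover J| - 2) * q ^+ #|J|.-1.
Proof.
move=> n_gt0 le_q sJ; rewrite -card_gt0; case cardJ : #|J| => [//|[|j]] _ /=.
  by rewrite expr0 mulr1 exprn_ege1 // ler1n.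
have J_gt1 : (1 < #|J|)%N by rewrite cardJ.
have x_gt0 : 0 < n%:R :> R by rewrite ltr0n.
have m2_gt0 : 0 < m2 R H := lt_le_trans ltr01 m2_ge1.
apply: (@le_trans _ _ (n%:R `^ (#|cover J|%:R - 2) * threshold n ^+ j.+1)).
  rewrite -powR_mulrn ?powR_ge0 // -powRrM -powRD ?(gt_eqF x_gt0) ?implybT //.
  rewrite -[leLHS](powRr0 n%:R) ler_powR ?ler1n // mulNr subr_ge0 mul1r mulrC ler_pdivrMr //.
  have := d2_le_m2 sJ J_gt1; rewrite cardJ -!natr1 [_ * m2 R H]mulrC.
  by rewrite addrK.
have -> : n%:R `^ (#|cover J|%:R - 2) = n%:R ^+ (#|cover J| - 2) :> R.
  by rewrite -powR_mulrn ?(ltW x_gt0) // natrB // ltnW // card_cover_edges_gt2.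
apply: ler_wpM2l; first by rewrite exprn_ge0 // ltW.
by apply: lerXn2r => //; rewrite nnegrE ?(le_trans _ le_q) // ltW // threshold_gt0.
Qed.

Lemma card_embeddings_through_le (n : nat) (B : {set {set 'I_n}}) : B \subset pairs n ->
  (#|[set f : {ffun V -> 'I_n} | injectiveb f && (B \subset edge_image H f)]|
    <= \sum_(J : {set {set V}} | (J \subset edges H) && (#|J| == #|B|))
         (2 * #|B|) ^ #|cover J| * n ^ (#|V| - #|cover J|))%N.
Proof.
move=> sBP; have card_coverB : (#|cover B| <= 2 * #|B|)%N.
  apply: leq_trans (leq_card_cover B) _; rewrite mulnC -sum_nat_const.
  by apply: leq_sum => e /(subsetP sBP); rewrite inE => /eqP->.
pose F (J : {set {set V}}) :=
  [set f : {ffun V -> 'I_n} | [forall x in cover J, f x \in cover B]].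
apply: (@leq_trans (\sum_(J : {set {set V}} | (J \subset edges H) && (#|J| == #|B|)) #|F J|)%N).
  apply: leq_card_cover_family => f; rewrite inE => /andP[/injectiveP f_inj sB].
  pose J := [set e in edges H | f @: (e : {set V}) \in B].
  have imJ : [set f @: (e : {set V}) | e in J] = B.
    apply/setP => b; apply/imsetP/idP => [[e + ->]|bB]; first by rewrite inE => /andP[].
    have /imsetP[e eH eb] := subsetP sB _ bB.
    by exists e => //; rewrite inE eH -eb.
  exists J.
    rewrite -imJ card_imset ?eqxx ?andbT; last exact: imset_inj.
    by apply/subsetP => e; rewrite inE => /andP[].
  rewrite inE; apply/forall_inP => x /bigcupP[e]; rewrite inE => /andP[_ eB] xe.
  by apply/bigcupP; exists (f @: e) => //; apply: imset_f.
apply: leq_sum => J _.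
by have := leq_card_ffun_constrained (fun x (_ : x \in cover J) => card_coverB); rewrite card_ord.
Qed.

(* The first factor bounds the choices of the set J of edges of H mapped onto B,
   the second the maps from the vertices covered by J to those covered by B. *)
Definition degree_const : R := (2 ^ #|edges H| * (2 * #|edges H|) ^ #|V|)%:R.

Lemma degree_const_gt0 : 0 < degree_const.
Proof. by rewrite ltr0n muln_gt0 !expn_gt0 muln_gt0 card_edges_gt0. Qed.

Lemma spread_emb_weight (n : nat) (q : R) : (0 < n)%N -> threshold n <= q ->
  spread (emb_weight R H) #|edges H| (pairs n) degree_const q (n%:R ^+ (#|V| - 2)).
Proof.
move=> n_gt0 le_q; have q_ge0 : 0 <= q := le_trans (ltW (threshold_gt0 n_gt0)) le_q.
split=> [||B B_neq0]; [exact: emb_weight_ge0 | exact: uniform_emb_weight |].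
set bound := _ * _ ^+ (#|V| - 2); have bound_ge0 : 0 <= bound by rewrite mulr_ge0 ?exprn_ge0.
rewrite deg_emb_weight; set S := [set f | _].
have [->|[f0]] := set_0Vmem S; first by rewrite cards0 mulr_ge0 // ltW // degree_const_gt0.
rewrite inE => /andP[/injectiveP f0_inj sBf0].
have cardB : (#|B| <= #|edges H|)%N by rewrite -(card_edge_image H f0_inj) subset_leq_card.
have sBP : B \subset pairs n := subset_trans sBf0 (edge_image_pairs H f0_inj).
have := card_embeddings_through_le sBP; rewrite -(ler_nat R) natr_sum => /le_trans; apply.
apply: (@le_trans _ _ (\sum_(J in powerset (edges H)) ((2 * #|edges H|) ^ #|V|)%:R * bound)).
  rewrite big_mkcond [leRHS]big_mkcond; apply: ler_sum => J _; rewrite powersetE.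
  case: ifP => [/andP[sJ /eqP cardJ]|_]; last by case: ifP => // _; rewrite mulr_ge0.
  have J_neq0 : J != set0 by rewrite -card_gt0 cardJ card_gt0.
  have cover_ge2 := card_cover_edges sJ J_neq0.
  rewrite sJ natrM; apply: ler_pM => //.
    rewrite ler_nat (@leq_trans ((2 * #|edges H|) ^ #|cover J|)) ?leq_pexp2l ?max_card //.
      by rewrite leq_exp2r ?leq_mul2l // (ltnW cover_ge2).
    by rewrite muln_gt0 card_edges_gt0.
  rewrite natrX /bound -cardJ.
  have -> : (#|V| - 2 = (#|V| - #|cover J|) + (#|cover J| - 2))%N.
    by rewrite addnBA // subnK ?max_card.
  rewrite exprD mulrCA ler_peMr ?exprn_ge0 // mulrC.
  exact: subgraph_expectation_ge1.
by rewrite sumr_const card_powerset -[leLHS]mulr_natl /degree_const natrM mulrA.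
Qed.

End GraphParameters.

Section Copies.
Variables (V : finType) (H : sgraph V) (n : nat) (G : sgraph 'I_n).

Definition copy_of (f : {ffun V -> 'I_n}) : vepair 'I_n :=
  ([set f x | x : V], edge_image H f).

Lemma copy_of_copies (f : {ffun V -> 'I_n}) :
  f \in embeddings H (edges G) -> copy_of f \in copies H G.
Proof.
rewrite inE => /andP[f_inj sf]; rewrite !inE /= sf /=; apply/andP; split.
  apply/forall_inP => _ /imsetP[e _ ->]; apply/subsetP => _ /imsetP[x _ ->].
  exact: imset_f.
by apply/existsP; exists f; rewrite f_inj eqxx.
Qed.

Lemma card_copies_le : (#|copies H G| <= #|embeddings H (edges G)|)%N.
Proof.
apply: leq_trans (leq_imset_card copy_of _); apply: subset_leq_card.
apply/subsetP => J; rewrite !inE => /andP[/andP[sJ _] /existsP[f /andP[f_inj /eqP JE]]].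
by apply/imsetP; exists f => //; rewrite inE f_inj; rewrite JE in sJ.
Qed.

Section Colouring.
Variables (r : nat) (c : {ffun {e : {set 'I_n} | e \in edges G} -> 'I_r}).

Definition edge_class i : {set {set 'I_n}} :=
  [set val e | e : {e : {set 'I_n} | e \in edges G} & c e == i].

Lemma edge_class_sub i : edge_class i \subset edges G.
Proof. by apply/subsetP => _ /imsetP[e _ ->]; apply: valP. Qed.

Lemma edge_class_uniq i j e : e \in edge_class i -> e \in edge_class j -> i = j.
Proof.
move=> /imsetP[d + ->] /imsetP[d' + /val_inj dd'].
by rewrite !inE -dd' => /eqP <- /eqP.
Qed.

Lemma copy_of_mono_copies i (f : {ffun V -> 'I_n}) :
  f \in embeddings H (edge_class i) -> copy_of f \in mono_copies H c.
Proof.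
rewrite inE => /andP[f_inj sf]; rewrite inE copy_of_copies ?inE ?f_inj /=; last first.
  exact: subset_trans sf (edge_class_sub i).
apply/existsP; exists i; apply/forallP => e; apply/implyP => /(subsetP sf)/imsetP[d + /val_inj->].
by rewrite inE.
Qed.

Lemma card_embeddings_class_le i :
  (#|embeddings H (edge_class i)| <= #|V| ^ #|V| * #|mono_copies H c|)%N.
Proof.
pose F (J : vepair 'I_n) := [set f : {ffun V -> 'I_n} | injectiveb f && (copy_of f == J)].
apply: (@leq_trans (\sum_(J in mono_copies H c) #|F J|)).
  apply: leq_card_cover_family => f emb_f; exists (copy_of f).
    exact: copy_of_mono_copies emb_f.
  by move: emb_f; rewrite !inE eqxx => /andP[->].
rewrite mulnC -sum_nat_const; apply: leq_sum => J _.
have [->|[f0]] := set_0Vmem (F J); first by rewrite cards0.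
rewrite inE => /andP[/injectiveP f0_inj /eqP <-].
rewrite -{1}(card_imset predT f0_inj) -card_ffun_on; apply: subset_leq_card.
apply/subsetP => f; rewrite inE => /andP[_ /eqP[im_f _]].
by apply/ffun_onP => x; rewrite -im_f imset_f.
Qed.

Lemma card_mono_copies_le : (#|mono_copies H c| <= #|copies H G|)%N.
Proof. by apply: subset_leq_card; apply/subsetP => J; rewrite inE => /andP[]. Qed.

End Colouring.

Lemma multiplicity_le r : (multiplicity r H G <= #|copies H G|)%N.
Proof.
rewrite /multiplicity; elim/big_rec: _ => // c x _ le_x.
exact: leq_trans (geq_minr _ _) le_x.
Qed.

Lemma mono_copies_le_multiplicity r : (0 < r)%N ->
  exists c : {ffun {e : {set 'I_n} | e \in edges G} -> 'I_r},
    (#|mono_copies H c| <= multiplicity r H G)%N.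
Proof.
move=> r_gt0; rewrite /multiplicity; elim/big_ind: _ => [|x y [c le_x] [d le_y]|c _].
- by exists [ffun=> Ordinal r_gt0]; apply: card_mono_copies_le.
- by rewrite /minn; case: ifP => _; [exists c | exists d].
- by exists c.
Qed.

Lemma multiplicity1 : multiplicity 1 H G = #|copies H G|.
Proof.
apply/eqP; rewrite eqn_leq multiplicity_le.
have [//|c] := @mono_copies_le_multiplicity 1; apply: leq_trans; apply: subset_leq_card.
apply/subsetP => J JH; rewrite inE JH /=.
by apply/existsP; exists ord0; apply/forallP => e; rewrite [c e]ord1 eqxx implybT.
Qed.

End Copies.

(** * Robustness *)

Lemma card_pairs_le (n : nat) : (#|pairs n| <= n ^ 2)%N.
Proof.
rewrite card_draws card_ord bin2 leq_half_double -mulnn -addnn.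
by rewrite (leq_trans (leq_mul (leqnn n) (leq_pred n))) // leqW // leq_addr.
Qed.

Lemma expRN_le_inv (R : realType) (x : R) : 0 < x -> expR (- x) <= x^-1.
Proof.
move=> x_gt0; rewrite expRN lef_pV2 ?posrE ?expR_gt0 //.
by apply: le_trans (expR_ge1Dx x); rewrite lerDr.
Qed.

Section Fingerprints.
Variables (R : realType) (n r : nat).
Implicit Types (F C : {set {set 'I_n}} -> {set {set 'I_n}}) (G : sgraph 'I_n).

Lemma colouring_fingerprint F C G (c : {ffun {e : {set 'I_n} | e \in edges G} -> 'I_r}) :
    (forall I : {set {set 'I_n}}, I \subset pairs n -> F I \subset I /\ I \subset C (F I)) ->
  exists kappa : {ffun {set 'I_n} -> option 'I_r},
    (forall i, colour_class kappa i = F (edge_class c i)) /\ captures C kappa G.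
Proof.
move=> FC; have class_pairs i : edge_class c i \subset pairs n.
  exact: subset_trans (edge_class_sub c i) (edges_sub_pairs G).
have sF i : {subset F (edge_class c i) <= edge_class c i}.
  by apply/subsetP; case: (FC _ (class_pairs i)).
pose kappa : {ffun {set 'I_n} -> option 'I_r} := [ffun e => [pick i | e \in F (edge_class c i)]].
have classE i : colour_class kappa i = F (edge_class c i).
  apply/setP => e; rewrite inE ffunE; case: pickP => [j ej|none]; last by rewrite none.
  by apply/eqP/idP => [[<-] //|ei]; rewrite (edge_class_uniq (sF _ _ ei) (sF _ _ ej)).
exists kappa; split=> //; apply/andP; split; apply/subsetP => e.
  rewrite inE ffunE; case: pickP => // i ei _.
  exact: (subsetP (edge_class_sub c i)) (sF _ _ ei).
move=> eG; apply/bigcupP; exists (c (exist _ e eG)) => //; rewrite classE.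
have [_ sC] := FC _ (class_pairs (c (exist _ e eG))); apply: (subsetP sC).
by apply/imsetP; exists (exist _ e eG); rewrite ?inE.
Qed.

Lemma few_mono_copies_captured (V : finType) (H : sgraph V) F C G
    (c : {ffun {e : {set 'I_n} | e \in edges G} -> 'I_r}) (s t y z m : R) :
    r%:R * s <= t ->
    (forall I : {set {set 'I_n}}, I \subset pairs n ->
      [/\ F I \subset I, I \subset C (F I), #|F I|%:R <= s &
          mass (emb_weight R H) I < z -> mass (emb_weight R H) (C (F I)) < y]) ->
    (forall D : 'I_r -> {set {set 'I_n}},
      (forall i, mass (emb_weight R H) (D i) < y) -> m <= #|uncovered D|%:R) ->
    #|V|%:R ^+ #|V| * #|mono_copies H c|%:R < z ->
  captured r C t m G.
Proof.
move=> le_t containers super few; have class_pairs i : edge_class c i \subset pairs n.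
  exact: subset_trans (edge_class_sub c i) (edges_sub_pairs G).
have few_i i : mass (emb_weight R H) (edge_class c i) < z.
  apply: le_lt_trans few; rewrite mass_emb_weight -natrX -natrM ler_nat.
  exact: card_embeddings_class_le.
have [I|kappa [classE capt]] := @colouring_fingerprint F C G c.
  by case/containers.
apply/existsP; exists kappa; rewrite capt andbT; apply/andP; split.
  apply: le_trans le_t; apply: (@le_trans _ _ (\sum_i #|colour_class kappa i|)%:R).
    by rewrite ler_nat card_coloured_le.
  rewrite natr_sum mulr_natl -[in leRHS](card_ord r) -sumr_const.
  by apply: ler_sum => i _; rewrite classE; case: (containers _ (class_pairs i)).
apply: super => i; rewrite classE.
by have [_ _ _] := containers _ (class_pairs i); apply.
Qed.

Lemma Gnp_prob_captured_sparse_le C (p delta t : R) :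
    0 <= p <= 1 -> (0 < r)%N -> 0 < delta ->
    t <= delta ^+ 2 / (16 * r%:R) * (p * n%:R ^+ 2) ->
  Gnp_prob p (captured r C t (delta * n%:R ^+ 2)) <= expR (- (delta / 2 * (p * n%:R ^+ 2))).
Proof.
move=> p01 r_gt0 delta_gt0 t_le; have [p_ge0 _] := andP p01.
have rr_gt0 : 0 < r%:R :> R by rewrite ltr0n.
pose a := 4 * r%:R / delta; have a_gt0 : 0 < a by rewrite divr_gt0 // mulr_gt0.
apply: le_trans (Gnp_prob_captured_le p01 r C _ _ (ltW a_gt0)) _; rewrite ler_expR.
have fingerprint_small : a * t <= delta / 4 * (p * n%:R ^+ 2).
  apply: le_trans (ler_wpM2l (ltW a_gt0) t_le) _; rewrite [leLHS]mulrA.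
  have -> // : a * (delta ^+ 2 / (16 * r%:R)) = delta / 4.
  by rewrite /a; field; rewrite !gt_eqF.
have product_small : r%:R * p * expR (- a) * #|pairs n|%:R <= delta / 4 * (p * n%:R ^+ 2).
  apply: (@le_trans _ _ (r%:R * p * a^-1 * n%:R ^+ 2)).
    apply: ler_pM; rewrite ?mulr_ge0 ?expR_ge0 //.
      by apply: ler_wpM2l (expRN_le_inv a_gt0); rewrite mulr_ge0.
    by rewrite -natrX ler_nat card_pairs_le.
  have -> // : r%:R * p * a^-1 * n%:R ^+ 2 = delta / 4 * (p * n%:R ^+ 2).
  by rewrite /a; field; rewrite !gt_eqF.
lra.
Qed.

End Fingerprints.

Section Robustness.
Variables (R : realType) (r : nat) (V : finType) (H : sgraph V).
Hypotheses (hr : (2 <= r)%N) (hH : (2 <= maxdeg H)%N).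

Local Notation k := #|edges H|.
Local Notation v := #|V|.

Let r_gt0 : (0 < r)%N. Proof. exact: ltnW. Qed.

Lemma robustness_ge (n : nat) (G : sgraph 'I_n) (x y : R) : 0 < x -> 0 < y ->
    (forall c : {ffun {e : {set 'I_n} | e \in edges G} -> 'I_r}, x <= #|mono_copies H c|%:R) ->
    mass (emb_weight R H) (edges G) <= y ->
  x / y <= robustness R r H G.
Proof.
move=> x_gt0 y_gt0 mono_ge mass_le.
have mult_ge : x <= (multiplicity r H G)%:R.
  have [c le_c] := mono_copies_le_multiplicity H G r_gt0.
  by apply: le_trans (mono_ge c) _; rewrite ler_nat.
have copies_le : #|copies H G|%:R <= y.
  by apply: le_trans mass_le; rewrite mass_emb_weight ler_nat card_copies_le.
have copies_gt0 : 0 < #|copies H G|%:R :> R.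
  by apply: lt_le_trans x_gt0 (le_trans mult_ge _); rewrite ler_nat multiplicity_le.
rewrite /robustness multiplicity1 ler_pdivlMr // mulrAC ler_pdivrMr //.
by apply: ler_pM => //; apply: ltW.
Qed.

Lemma few_mono_copies_fingerprint : exists (alpha theta delta : R) (n0 : nat),
  [/\ 0 < alpha, 0 < theta <= 1, 0 < delta &
  forall (n : nat) (p : R), (n0 < n)%N -> theta^-1 * threshold R H n <= p -> p <= 1 ->
  exists C : {set {set 'I_n}} -> {set {set 'I_n}}, forall (G : sgraph 'I_n)
    (c : {ffun {e : {set 'I_n} | e \in edges G} -> 'I_r}),
  v%:R ^+ v * #|mono_copies H c|%:R < alpha * (n%:R ^+ v * p ^+ k) ->
  captured r C (delta ^+ 2 / (16 * r%:R) * (p * n%:R ^+ 2)) (delta * n%:R ^+ 2) G].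
Proof.
have [eps [delta [n0 [eps_gt0 delta_gt0 super]]]] := supersaturation r H R.
have [alpha [s [q1 [alpha_gt0 s_gt0 q1_gt0 containers]]]] :=
  sparse_containers k (degree_const_gt0 R hH) eps_gt0.
have rr_gt0 : 0 < r%:R :> R by rewrite ltr0n.
pose theta := Num.min 1 (Num.min q1 (delta ^+ 2 / (16 * r%:R) / (r%:R * s))).
have theta_gt0 : 0 < theta.
  by rewrite !lt_min ltr01 q1_gt0 /= !divr_gt0 ?exprn_gt0 ?mulr_gt0.
exists (alpha * theta ^+ k), theta, delta, n0; split=> //.
- by rewrite mulr_gt0 // exprn_gt0.
- by rewrite theta_gt0 ge_min lexx.
move=> n p n_large; rewrite ler_pdivrMl // => le_q p_le1.
have n_gt0 : (0 < n)%N by apply: leq_trans n_large.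
have x_ge1 : 1 <= n%:R :> R by rewrite ler1n.
have q_gt0 : 0 < theta * p := lt_le_trans (threshold_gt0 R H n_gt0) le_q.
have qx_ge1 : 1 <= theta * p * n%:R ^+ 2.
  by rewrite expr2 mulrA mulr_ege1 // (mulr_ge1_threshold hH n_gt0 le_q).
have pow_v : n%:R ^+ (v - 2) * n%:R ^+ 2 = n%:R ^+ v :> R.
  by rewrite -exprD subnK // (card_vertices_ge2 hH).
have q_le_q1 : theta * p <= q1.
  apply: le_trans (_ : theta <= q1); last by rewrite !ge_min lexx orbT.
  by rewrite ler_piMr // ltW.
have pairs_le : #|pairs n|%:R <= n%:R ^+ 2 :> R by rewrite -natrX ler_nat card_pairs_le.
have M_gt0 : 0 < n%:R ^+ (v - 2) :> R by rewrite exprn_gt0 // (lt_le_trans ltr01).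
have [F [C FC]] := containers _ _ _ _ _ _ q_gt0 q_le_q1 M_gt0 qx_ge1 pairs_le
  (spread_emb_weight hH n_gt0 le_q).
exists C => G c few.
apply: few_mono_copies_captured FC _ (lt_le_trans few _).
- have -> : r%:R * (s * (theta * p * n%:R ^+ 2)) = theta * (r%:R * s) * (p * n%:R ^+ 2) by ring.
  apply: ler_wpM2r; last by rewrite -ler_pdivlMr ?mulr_gt0 // !ge_min lexx !orbT.
  by rewrite mulr_ge0 ?exprn_ge0 // ltW // -(pmulr_rgt0 _ theta_gt0).
- by move=> D; rewrite pow_v; apply: super; apply: ltnW.
- by rewrite pow_v exprMn -!mulrA [p ^+ k * _]mulrC.
Qed.

Lemma Gnp_prob_many_copies_le (n : nat) (p : R) : (0 < n)%N -> 0 <= p <= 1 ->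
    threshold R H n <= p ->
  Gnp_prob p (fun G : sgraph 'I_n => 2 * (n%:R ^+ v * p ^+ k) <= mass (emb_weight R H) (edges G))
    <= 2 ^+ k * degree_const R H / n%:R.
Proof.
move=> n_gt0 p01 threshold_le; have [p_ge0 _] := andP p01.
have x_gt0 : 0 < n%:R :> R by rewrite ltr0n.
have p_gt0 : 0 < p := lt_le_trans (threshold_gt0 R H n_gt0) threshold_le.
set K := degree_const R H; have K_ge0 : 0 <= K by rewrite ltW // degree_const_gt0.
set y := n%:R ^+ v * p ^+ k; have y_gt0 : 0 < y by rewrite mulr_gt0 // exprn_gt0.
set M : R := n%:R ^+ (v - 2); have M_ge0 : 0 <= M by rewrite exprn_ge0 // ltW.
have total_le : \sum_(A : {set {set 'I_n}}) emb_weight R H A <= n%:R ^+ v :> R.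
  rewrite (sum_emb_weight _ _ predT) -natrX ler_nat; apply: leq_trans (max_card _) _.
  by rewrite card_ffun card_ord.
have := mass_upper_tail p01 K_ge0 M_ge0 (spread_emb_weight hH n_gt0 threshold_le) y_gt0.
set W := \sum_A _ in total_le *; move=> tail.
apply: le_trans (le_trans _ tail) _.
  apply: Gnp_prob_subset => // G; apply: le_trans.
  by rewrite mulr_natl mulr2n lerD2r ler_wpM2r ?exprn_ge0.
rewrite ler_pdivrMr ?exprn_gt0 //.
have y_sq : y ^+ 2 = n%:R ^+ v * (M * n%:R ^+ 2) * (p * p ^+ (2 * k).-1).
  rewrite -exprS prednK ?muln_gt0 ?card_edges_gt0 // /M -exprD subnK ?(card_vertices_ge2 hH) //.
  by rewrite /y mulnC exprM exprMn -expr2.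
set P := p ^+ (2 * k).-1 in y_sq *; have P_ge0 : 0 <= P by rewrite exprn_ge0.
have bound_ge0 : 0 <= 2 ^+ k * (K * (P * M)) by rewrite !mulr_ge0 ?exprn_ge0.
apply: le_trans (ler_wpM2r bound_ge0 total_le) _; rewrite y_sq.
have -> : 2 ^+ k * K / n%:R * (n%:R ^+ v * (M * n%:R ^+ 2) * (p * P)) =
    n%:R ^+ v * (2 ^+ k * (K * (P * M))) * (p * n%:R).
  move: (K) (M) (P) (n%:R : R) x_gt0 (n%:R ^+ v) (2 ^+ k) => K' M' P' x x_gt0' u z.
  by field; rewrite gt_eqF.
apply: ler_peMr (mulr_ge1_threshold hH n_gt0 threshold_le).
by rewrite mulr_ge0 ?exprn_ge0 // ltW.
Qed.

Lemma robustness_probability : exists (eta D B : R) (n0 : nat), 0 < eta /\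
  forall (n : nat) (p : R), (n0 < n)%N -> 0 <= p <= 1 -> D * threshold R H n <= p ->
  1 - B / n%:R <= Gnp_prob p (fun G : sgraph 'I_n => eta <= robustness R r H G).
Proof.
have [alpha [theta [delta [n0 [alpha_gt0 /andP[theta_gt0 theta_le1] delta_gt0 fragile]]]]] :=
  few_mono_copies_fingerprint.
pose K := degree_const R H.
pose labellings : R := v%:R ^+ v.
have labellings_gt0 : 0 < labellings.
  by rewrite exprn_gt0 // ltr0n (leq_trans _ (card_vertices_ge2 hH)).
exists (alpha / labellings / 2), theta^-1, (2 / delta + 2 ^+ k * K), n0.
split=> // [|n p n_large p01 le_p]; first by rewrite !divr_gt0.
have n_gt0 : (0 < n)%N by apply: leq_trans n_large.
have [_ p_le1] := andP p01.
have [C captured_G] := fragile n p n_large le_p p_le1.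
have threshold_le : threshold R H n <= p.
  by apply: le_trans le_p; rewrite ler_peMl ?invf_ge1 // ltW // threshold_gt0.
have p_gt0 : 0 < p := lt_le_trans (threshold_gt0 R H n_gt0) threshold_le.
have x_gt0 : 0 < n%:R :> R by rewrite ltr0n.
pose y := n%:R ^+ v * p ^+ k; have y_gt0 : 0 < y by rewrite mulr_gt0 // exprn_gt0.
pose m := delta * n%:R ^+ 2; pose t := delta ^+ 2 / (16 * r%:R) * (p * n%:R ^+ 2).
have captured_le : Gnp_prob p (captured r C t m) <= 2 / delta / n%:R.
  apply: le_trans (Gnp_prob_captured_sparse_le C p01 r_gt0 delta_gt0 (lexx _)) _.
  have pn_gt0 : 0 < p * n%:R ^+ 2 by rewrite mulr_gt0 ?exprn_gt0.
  apply: le_trans (expRN_le_inv _) _; first by rewrite mulr_gt0 // divr_gt0.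
  rewrite invfM invf_div ler_pM2l ?divr_gt0 // lef_pV2 ?posrE //.
  by rewrite expr2 mulrA; apply: ler_peMl (ltW x_gt0) (mulr_ge1_threshold hH n_gt0 threshold_le).
rewrite Gnp_prob_compl // lerD2l lerN2 [leRHS]mulrDl.
apply: le_trans (lerD captured_le (Gnp_prob_many_copies_le n_gt0 p01 threshold_le)).
apply: le_trans (Gnp_prob_union_le p01 _ _).
apply: Gnp_prob_subset => // G; apply: contraR; rewrite negb_or -ltNge => /andP[ncapt few_copies].
have -> : alpha / labellings / 2 = alpha * y / labellings / (2 * y).
  by move: (y) y_gt0 => z z_gt0; field; rewrite !gt_eqF.
apply: robustness_ge (ltW few_copies) => [||c].
- by rewrite divr_gt0 // (mulr_gt0 alpha_gt0 y_gt0).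
- by rewrite mulr_gt0.
rewrite leNgt; apply: contra ncapt; rewrite ltr_pdivlMr // mulrC.
exact: captured_G.
Qed.

End Robustness.

Local Open Scope classical_set_scope.
Local Open Scope ring_scope.

Theorem theorem4p4 (R : realType) (r : nat) (hr : (2 <= r)%N)
    (V : finType) (H : sgraph V) (hH : (2 <= maxdeg H)%N) :
  exists eta C : R, 0 < eta /\
    forall p : nat -> R,
      (forall n : nat, 0 <= p n <= 1) ->
      (\forall n \near \oo, C * n%:R `^ (- (1 / m2 R H)) <= p n) ->
      (fun n : nat => Gnp_prob (p n)
         (fun G : sgraph 'I_n => eta <= robustness R r H G)) @ \oo --> (1 : R).
Proof.
have [eta [D [B [n0 [eta_gt0 bound]]]]] := robustness_probability R hr hH.
exists eta, D; split=> // p p01 le_p.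
have lower_cvg : (fun n : nat => 1 - B / n%:R) @ \oo --> (1 : R).
  rewrite -[X in _ --> X]subr0 -[X in _ --> _ - X](mulr0 B).
  apply: cvgB; first exact: cvg_cst.
  apply: cvgM; first exact: cvg_cst.
  rewrite -(cvg_shiftS (fun n : nat => n%:R^-1 : R)); exact: cvg_harmonic.
apply: (squeeze_cvgr (h := fun=> 1)) lower_cvg _; last exact: cvg_cst.
near=> n; rewrite Gnp_prob_le1 // andbT.
apply: bound => //; last by near: n.
by near: n; exists n0.+1.
Unshelve. all: by end_near.
Qed.
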